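(* Fix one of the four types of finite elements (linear, bilinear, Crouzeix-Raviart, rotated-$Q_1$) and let the unisolvence conditions stated in the context hold. Then on every interface element $T\in\mathcal T_h^i$ the IFE shape functions satisfy $$\sum_{i\in\mathcal I}\phi^P_{i,T}(X)=1,\qquad \forall X\in T,$$ $$\nabla\Big(\sum_{i\in\mathcal I}\phi^P_{i,T}(X)\Big)=\sum_{i\in\mathcal I}\nabla\phi^P_{i,T}(X)=0,\qquad\forall X\in T.$$
   Context: Mesh and interface. $\Omega\subset\mathbb R^2$ is a bounded domain that is a union of finitely many rectangles; a curve $\Gamma$ separates $\Omega$ into subdomains $\Omega^-,\Omega^+$. $\mathcal T_h$ is a Cartesian triangular or rectangular mesh of $\Omega$ with maximum edge length $h$; a typical element has vertices $A_1=(0,0),A_2=(h,0),A_3=(h,h)$ (triangle), or additionally $A_4=(0,h)$ (rectangle). An element whose interior meets $\Gamma$ is an interface element; $\mathcal T_h^i$ is the set of these. Standing hypotheses: $\Gamma$ meets an edge of an element in at most two points unless the edge is part of $\Gamma$; if $\Gamma$ meets the boundary of an element at two points, these are on different edges; $\Gamma$ is piecewise $C^2$, and its portion in each interface element is $C^2$. For $T\in\mathcal T_h^i$: $T^s=T\cap\Omega^s$, $s=\pm$; $D,E$ are the intersection points of $\Gamma$ with $\partial T$; $l$ is the line through $D$ and $E$ with unit normal $\bar{\mathbf n}$; $\mathbf n(\widetilde X)$ is the unit normal of $\Gamma$ at $\widetilde X\in\Gamma\cap T$; all normals are oriented from $T^-$ to $T^+$. In the local coordinates with origin $D$ and first axis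 along $l$, $\Gamma\cap T$ is a graph $\{(\xi,\omega(\xi)):\xi\in[0,\xi_E]\}$, where $E=(\xi_E,0)$. $\kappa$ is the maximum curvature of $\Gamma$. Coefficients: $\beta^\pm>0$ are constants with $\beta^+\ge\beta^-$, and $\rho=\beta^-/\beta^+\le 1$. Finite elements: $\Pi_T=\mathrm{Span}\{1,x,y\}$ (linear or Crouzeix-Raviart, triangles), $\mathrm{Span}\{1,x,y,xy\}$ (bilinear, rectangles), or $\mathrm{Span}\{1,x,y,x^2-y^2\}$ (rotated-$Q_1$, rectangles). $\mathcal I=\{1,2,3\}$ for triangles and $\{1,2,3,4\}$ for rectangles. The nodes $M_i$ are the vertices of $T$ (linear, bilinear) or the midpoints of the edges of $T$ (Crouzeix-Raviart, rotated-$Q_1$). $\mathcal I$ is partitioned into $\mathcal I^\pm=\{i: M_i\in T^\pm\}$. For $p\in\Pi_T$, $T$ rectangular, $d(p)$ is the coefficient of its second degree term. Unisolvence conditions. Fixed $\epsilon\in(0,\sqrt2/2)$, $\bar\kappa\in(0,1]$ with $h<\min\{\sqrt{\bar\kappa}/(\sqrt2(1+(1-2\epsilon^2)^{-3/2})\kappa),\ \epsilon/\kappa\}$; in the bilinear case $\sqrt{\bar\kappa}<\frac1{4\sqrt2}$; in the rotated-$Q_1$ case $\sqrt{\bar\kappa}\le\frac{\rho(1-\lambda)}{4-(3+\lambda)\rho}$ for some $\lambda\in(0,1)$. On each $T\in\mathcal T_h^i$ a point $F\in\Gamma\cap T$ is fixed with $\mathbf n(F)=\bar{\mathbf n}$ (linear,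 Crouzeix-Raviart), with orthogonal projection $F_\bot$ onto $l$ equal to the midpoint of $\overline{DE}$ (bilinear), arbitrary (rotated-$Q_1$). IFE shape functions. Under these conditions $\phi^P_{i,T}$ is the unique function equal to $\phi^{P-}_{i,T}\in\Pi_T$ on $T^-$ and $\phi^{P+}_{i,T}\in\Pi_T$ on $T^+$ with: $\phi^{P-}_{i,T}|_l=\phi^{P+}_{i,T}|_l$ and, for rectangular $T$, $d(\phi^{P-}_{i,T})=d(\phi^{P+}_{i,T})$; $\beta^-\nabla\phi^{P-}_{i,T}(F)\cdot\mathbf n(F)=\beta^+\nabla\phi^{P+}_{i,T}(F)\cdot\mathbf n(F)$; $\phi^P_{i,T}(M_j)=\delta_{ij}$, $j\in\mathcal I$. Gradients are taken piecewise on $T^-$ and $T^+$. *)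

(* Defs.v *)
From HB Require Import structures.
From mathcomp Require Import all_boot all_order all_algebra.
From mathcomp Require Import all_classical all_reals all_analysis.
Import Order.TTheory GRing.Theory Num.Theory.
Import numFieldNormedType.Exports.

Set Implicit Arguments.
Unset Strict Implicit.
Unset Printing Implicit Defensive.

Local Open Scope classical_set_scope.
Local Open Scope ring_scope.

(* * Plane geometry *)

Definition dot (R : realType) (X Y : R * R) : R := X.1 * Y.1 + X.2 * Y.2.

(* The library norm on R * R is the sup norm; this is the Euclidean one. *)
Definition enorm (R : realType) (X : R * R) : R := Num.sqrt (dot X X).

Definition grad (R : realType) (f : R * R -> R) (X : R * R) : R * R :=
  ('D_((1, 0) : R * R) f X, 'D_((0, 1) : R * R) f X).

Definition line (R : realType) (D E : R * R) : set (R * R) :=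
  [set X | exists t : R, X = D + t *: (E - D)].

Definition conv (R : realType) (n : nat) (A : {ffun 'I_n -> R * R})
    (J : {pred 'I_n}) : set (R * R) :=
  [set X | exists w : 'I_n -> R,
    [/\ forall i, 0 <= w i, forall i, i \notin J -> w i = 0,
        \sum_i w i = 1 & X = \sum_i w i *: A i]].

Definition rect (R : realType) (r : (R * R) * (R * R)) : set (R * R) :=
  [set X | r.1.1 <= X.1 <= r.1.2 /\ r.2.1 <= X.2 <= r.2.2].

Definition domain (R : realType) (O : set (R * R)) : Prop :=
  [/\ open O, connected O & O !=set0].

(* A bounded domain which is, up to its boundary, a union of rectangles. *)
Definition rect_domain (R : realType) (O : set (R * R)) : Prop :=
  [/\ domain O, bounded_set O &
    exists rs : seq ((R * R) * (R * R)),
      (forall r, r \in rs -> r.1.1 < r.1.2 /\ r.2.1 < r.2.2) /\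
      closure O = \bigcup_(r in [set` rs]) rect r].

(* * Curves *)

(* A C^2 function on a closed interval is represented by a C^2 extension to
   the whole line: one-sided derivatives at the endpoints are then ordinary
   derivatives. *)
Definition C2 (R : realType) (f : R -> R) : Prop :=
  [/\ forall x, derivable f x 1, forall x, derivable (derive1 f) x 1 &
      continuous (derive1 (derive1 f))].

Definition velocity (R : realType) (c : R -> R * R) (t : R) : R * R :=
  (derive1 (fun s => (c s).1) t, derive1 (fun s => (c s).2) t).

Definition C2_arc (R : realType) (c : R -> R * R) (a b : R) : Prop :=
  [/\ a < b, C2 (fun s => (c s).1), C2 (fun s => (c s).2) &
      forall t, a <= t <= b -> velocity c t != 0].

Definition curvature (R : realType) (c : R -> R * R) (t : R) : R :=
  let v := velocity c t in
  let a := velocity (velocity c) t in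
  `|v.1 * a.2 - v.2 * a.1| / enorm v ^+ 3.

Definition curvatures (R : realType) (G : set (R * R)) : set R :=
  [set k | exists (c : R -> R * R) (a b t : R),
    [/\ C2_arc c a b, c @` `[a, b] `<=` G, a <= t <= b & k = curvature c t]].

Definition is_max_curvature (R : realType) (G : set (R * R)) (kappa : R) :=
  curvatures G kappa /\ ubound (curvatures G) kappa.

(* A simple curve, open or closed, made of N consecutive C^2 arcs; the point
   c j s is the one with global parameter j + s in [0, N]. *)
Definition piecewise_C2_curve (R : realType) (G : set (R * R)) : Prop :=
  exists (N : nat) (c : nat -> R -> R * R),
    [/\ (0 < N)%N,
        forall j, (j < N)%N -> C2_arc (c j) 0 1,
        forall j, (j.+1 < N)%N -> c j 1 = c j.+1 0,
        G = \bigcup_(j in [set j | (j < N)%N]) (c j @` `[0, 1]) &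
        forall j k s t, (j < N)%N -> (k < N)%N ->
          0 <= s <= 1 -> 0 <= t <= 1 -> c j s = c k t ->
          [\/ j%:R + s = k%:R + t,
              j%:R + s = 0 /\ k%:R + t = N%:R |
              j%:R + s = N%:R /\ k%:R + t = 0]].

Variant side := Minus | Plus.

Definition separates (R : realType) (G O : set (R * R))
    (Os : side -> set (R * R)) : Prop :=
  [/\ G `<=` closure O, forall s, domain (Os s),
      Os Minus `&` Os Plus = set0 & O `\` G = Os Minus `|` Os Plus].

(* * Finite elements *)

Variant fe_kind := Linear | Bilinear | CrouzeixRaviart | RotatedQ1.

Definition rectangular (k : fe_kind) : bool :=
  match k with Bilinear | RotatedQ1 => true | _ => false end.

(* The index set {1, ..., 3} or {1, ..., 4} is 'I_(nI k). *)
Definition nI (k : fe_kind) : nat := if rectangular k then 4 else 3.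

(* An element is given by its vertices. *)
Definition elt (R : realType) (k : fe_kind) := {ffun 'I_(nI k) -> R * R}.

Definition carrier (R : realType) (k : fe_kind) (A : elt R k) : set (R * R) :=
  conv A predT.

Definition edge (R : realType) (k : fe_kind) (A : elt R k) (i : 'I_(nI k)) :
  set (R * R) := conv A (pred2 i (ordS i)).

Definition boundary (R : realType) (k : fe_kind) (A : elt R k) : set (R * R) :=
  \bigcup_i edge A i.

Definition node (R : realType) (k : fe_kind) (A : elt R k) (i : 'I_(nI k)) :
    R * R :=
  match k with
  | Linear | Bilinear => A i
  | CrouzeixRaviart | RotatedQ1 => 2^-1 *: (A i + A (ordS i))
  end.

Definition ref_vertex (R : realType) (h : R) (i : nat) : R * R :=
  match i with 0 => (0, 0) | 1 => (h, 0) | 2 => (h, h) | _ => (0, h) end.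

(* The eight linear isometries preserving the pair of coordinate axes. *)
Definition axis_isometry (R : realType) (sw sx sy : bool) (X : R * R) : R * R :=
  let Y := if sw then (X.2, X.1) else X in ((-1) ^+ sx * Y.1, (-1) ^+ sy * Y.2).

(* The typical element, up to translation and axis-preserving isometry: this
   covers the right triangles obtained by cutting squares along either
   diagonal. *)
Definition cartesian_elt (R : realType) (k : fe_kind) (h : R) (A : elt R k) :=
  exists (P : R * R) (sw sx sy : bool),
    forall i, A i = P + axis_isometry sw sx sy (ref_vertex h i).

Definition cartesian_mesh (R : realType) (k : fe_kind) (O : set (R * R)) (h : R)
    (Th : seq (elt R k)) : Prop :=
  [/\ 0 < h,
      forall A, A \in Th -> cartesian_elt h A /\ (carrier A)° `<=` O,
      closure O = \bigcup_(A in [set` Th]) carrier A &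
      forall A A', A \in Th -> A' \in Th -> A != A' ->
        (carrier A)° `&` (carrier A')° = set0 /\
        carrier A `&` carrier A' = conv A [pred i | A i \in codom A']].

Definition interface_elt (R : realType) (k : fe_kind) (G : set (R * R))
    (Th : seq (elt R k)) (A : elt R k) : Prop :=
  A \in Th /\ (carrier A)° `&` G !=set0.

Definition standing_hypotheses (R : realType) (k : fe_kind) (G : set (R * R))
    (Th : seq (elt R k)) : Prop :=
  [/\ forall A i, A \in Th ->
        edge A i `<=` G \/ exists P Q, G `&` edge A i `<=` [set P; Q],
      forall A D E, A \in Th -> D <> E -> G `&` boundary A = [set D; E] ->
        exists i j, [/\ i != j, edge A i D & edge A j E],
      piecewise_C2_curve G &
      forall A, interface_elt G Th A ->
        exists c : R -> R * R,
          C2_arc c 0 1 /\ G `&` carrier A = c @` `[0, 1]].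

Definition sub_elt (R : realType) (k : fe_kind) (A : elt R k)
    (Os : side -> set (R * R)) (s : side) : set (R * R) := carrier A `&` Os s.

(* * The interface inside an element *)

(* nb is a unit normal of the line DE; the local coordinates have origin D,
   first axis along E - D and second axis along nb. *)
Definition local_pt (R : realType) (D E nb : R * R) (xi eta : R) : R * R :=
  D + xi *: ((enorm (E - D))^-1 *: (E - D)) + eta *: nb.

Definition local_abscissa (R : realType) (D E X : R * R) : R :=
  dot (X - D) ((enorm (E - D))^-1 *: (E - D)).

Definition proj_line (R : realType) (D E X : R * R) : R * R :=
  D + local_abscissa D E X *: ((enorm (E - D))^-1 *: (E - D)).

(* Unit normal at X of the graph of w, on the side of nb. *)
Definition interface_normal (R : realType) (D E nb : R * R) (w : R -> R)
    (X : R * R) : R * R :=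
  let p := derive1 w (local_abscissa D E X) in
  (Num.sqrt (1 + p ^+ 2))^-1 *:
    (nb - p *: ((enorm (E - D))^-1 *: (E - D))).

Definition local_interface (R : realType) (k : fe_kind) (G : set (R * R))
    (Os : side -> set (R * R)) (A : elt R k) (D E nb : R * R) (w : R -> R) :
    Prop :=
  [/\ D <> E /\ G `&` boundary A = [set D; E],
      dot nb nb = 1 /\ dot nb (E - D) = 0,
      C2 w,
      G `&` carrier A =
        [set local_pt D E nb xi (w xi) | xi in `[0, enorm (E - D)]] &
      (* the normals point from T^- to T^+ *)
      forall X, G X -> (carrier A)° X -> \forall d \near (0 : R)^'+,
        sub_elt A Os Plus (X + d *: interface_normal D E nb w X) /\
        sub_elt A Os Minus (X - d *: interface_normal D E nb w X)].

(* * Unisolvence conditions *)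

(* When kappa = 0 both bounds on h are infinite, hence the guard. *)
Definition unisolvence_conditions (R : realType) (k : fe_kind)
    (h kappa eps kbar rho : R) : Prop :=
  [/\ 0 < eps < Num.sqrt 2 / 2,
      0 < kbar <= 1,
      0 < kappa ->
        h < Num.min
              (Num.sqrt kbar /
                (Num.sqrt 2 * (1 + (1 - 2 * eps ^+ 2) `^ (- (3 / 2))) * kappa))
              (eps / kappa) &
      match k with
      | Bilinear => Num.sqrt kbar < 1 / (4 * Num.sqrt 2)
      | RotatedQ1 => exists2 lam : R, 0 < lam < 1 &
          Num.sqrt kbar <= rho * (1 - lam) / (4 - (3 + lam) * rho)
      | _ => True
      end].

Definition flux_point (R : realType) (k : fe_kind) (G : set (R * R))
    (A : elt R k) (D E nb : R * R) (w : R -> R) (F : R * R) : Prop :=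
  (G `&` carrier A) F /\
  match k with
  | Linear | CrouzeixRaviart => interface_normal D E nb w F = nb
  | Bilinear => proj_line D E F = 2^-1 *: (D + E)
  | RotatedQ1 => True
  end.

(* * IFE shape functions *)

(* Pi_T, by coefficients; deg2 is d(p), irrelevant on triangles. *)
Record poly2 (R : realType) := Poly2 { c0 : R; cx : R; cy : R; deg2 : R }.

Definition peval (R : realType) (k : fe_kind) (p : poly2 R) (X : R * R) : R :=
  c0 p + cx p * X.1 + cy p * X.2 +
  match k with
  | Bilinear => deg2 p * (X.1 * X.2)
  | RotatedQ1 => deg2 p * (X.1 ^+ 2 - X.2 ^+ 2)
  | _ => 0
  end.

(* Which of T^-, T^+ each point of T is counted in. Points of T in Omega^s are
   necessarily counted in T^s; points on Gamma or on the boundary of Omega are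
   counted in a subelement they are adherent to. *)
Definition side_rule (R : realType) (k : fe_kind) (A : elt R k)
    (Os : side -> set (R * R)) (sd : R * R -> side) : Prop :=
  forall X, carrier A X -> closure (sub_elt A Os (sd X)) X.

(* A piecewise function f is given by its two pieces f Minus and f Plus. *)
Definition pw_eval (R : realType) (sd : R * R -> side)
    (f : side -> R * R -> R) (X : R * R) : R := f (sd X) X.

Definition pw_grad (R : realType) (sd : R * R -> side)
    (f : side -> R * R -> R) (X : R * R) : R * R := grad (f (sd X)) X.

Definition ife (R : realType) (k : fe_kind) (phi : side -> poly2 R) :
  side -> R * R -> R := fun s => peval k (phi s).

Definition ife_shape (R : realType) (k : fe_kind) (A : elt R k)
    (D E nb : R * R) (w : R -> R) (beta : side -> R) (F : R * R)
    (sd : R * R -> side) (i : 'I_(nI k)) (phi : side -> poly2 R) : Prop :=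
  [/\ forall X, line D E X -> ife k phi Minus X = ife k phi Plus X,
      rectangular k -> deg2 (phi Minus) = deg2 (phi Plus),
      beta Minus *
        dot (grad (ife k phi Minus) F) (interface_normal D E nb w F) =
      beta Plus *
        dot (grad (ife k phi Plus) F) (interface_normal D E nb w F) &
      forall j, pw_eval sd (ife k phi) (node A j) = (i == j)%:R].

(* Main.v *)
(* Let v be the sum of the shape functions minus 1. Its two pieces agree on the
   chord DE and have the same second degree coefficient, so they differ by c L,
   where L is the signed distance to the chord; v vanishes at the nodes, whose
   sides of the interface are given by the sign of L. Hence v on the plus side is
   -c times the nodal interpolant W of min(L, 0), and the flux condition at F,
   with normal proportional to m = n - p t, where p is the slope of the interface
   at F over the chord, t and n being the unit tangent and normal of the chord
   (so that n.m = 1), becomes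
     c (beta^- + (beta^+ - beta^-) grad W(F) . m) = 0.
   The bracket is positive: for p = 0 and F on the chord the flux of W is
   nonnegative, essentially because min(., 0) is nondecreasing, and the
   unisolvence conditions make p and the distance from F to the chord small: the
   mean value theorem applied to the sine of the slope angle, whose derivative is
   the curvature, bounds p by about kappa h. So c = 0 and v = 0. *)

Require Import Defs.
From HB Require Import structures.
From mathcomp Require Import all_boot all_order all_algebra.
From mathcomp Require Import all_classical all_reals all_analysis.
From mathcomp Require Import ring lra.
Import Order.TTheory GRing.Theory Num.Theory.
Import numFieldNormedType.Exports.

Set Implicit Arguments.
Unset Strict Implicit.
Unset Printing Implicit Defensive.

Local Open Scope classical_set_scope.
Local Open Scope ring_scope.

(** * The flux of the bilinear interpolant of min(L, 0) *)

(** The positivity of the bracket is where the element types differ. On a triangle grad W is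
    constant and the choice of F gives p = 0, so monotonicity of min(., 0) along two legs suffices.
    On a square grad W varies with F and the tilt p mixes its components. In the bilinear case F
    projects to the middle of the chord; then a component of the normal that is ten times smaller
    than the other one forces the same component of grad W to be at most ten times the other, so
    that a slope up to 1/10 leaves the flux nonnegative for every ratio of the coefficients. In the
    rotated-Q1 case F is arbitrary and the flux is only bounded below by -5 q, q being a bound on
    the slope; the condition on kbar in terms of rho pays for this loss. The other obstacle is that
    a node is only known to be adherent to its subelement. That its side is the sign of L requires a
    connectedness argument in the element, carried up to the boundary, where the nodes lie. *)

Section NegativePart.
Variable R : realFieldType.
Implicit Types a b c x y u v p q z : R.

Local Notation neg a := (Num.min a 0).

Lemma min0P a : (a <= 0 /\ neg a = a) \/ (0 <= a /\ neg a = 0).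
Proof. by case: (leP a 0) => [|/ltW]; [left|right]. Qed.

Lemma neg_incr_bound a c : 0 <= c -> 0 <= neg (a + c) - neg a <= c.
Proof. by move=> c0; case: (min0P a) => -[? ->]; case: (min0P (a + c)) => -[? ->]; lra. Qed.

(** An increment of a nondecreasing function has the sign of its step; on triangles this is all that
    the positivity of the flux needs. *)
Lemma neg_incr_mul a c : 0 <= (neg (a + c) - neg a) * c.
Proof.
case: (lerP 0 c) => c0; first by have := neg_incr_bound a c0; nra.
have := @neg_incr_bound (a + c) (- c); rewrite addrK; nra.
Qed.


(* Up to the factor 10, the x-derivative at (x, y) of the bilinear interpolant of
   min(a + n1 x + n2 y, 0) on the unit square is dominated by its y-derivative
   when the zero line is nearly horizontal and x is close to the middle of its
   trace on the square. *)
Lemma bilinear_key_suff x y a n1 n2 :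
  0 <= y <= 1 ->
  let W := (1 - x) * (neg (a + n2) - neg a) +
           x * (neg (a + n1 + n2) - neg (a + n1)) in
  `|neg (a + n1) - neg a| <= 10 * W ->
  `|neg (a + n1 + n2) - neg (a + n2)| <= 10 * W ->
  `|(1 - y) * (neg (a + n1) - neg a) + y * (neg (a + n1 + n2) - neg (a + n2))|
   <= 10 * W.
Proof.
move=> hy W; move: W (neg (a + n1) - _) (_ - neg (a + n2)) => W B T.
rewrite !ler_norml; nra.
Qed.

(** The zero line meets the left side and does not strictly cross the right one. The increment along
    the left side is -a, it dominates both horizontal increments, and its weight 1 - x is at least
    4/10. The bound 6/10 is 1/2, which the middle of such a trace does not exceed, plus a tolerance
    of 1/10. *)
Lemma bilinear_key_left x y a n1 n2 :
  0 <= y <= 1 -> 0 <= x <= 6 / 10 -> `|n1| <= n2 / 10 ->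
  a <= 0 <= a + n2 -> (0 <= a + n1) || (a + n1 + n2 <= 0) ->
  `|(1 - y) * (neg (a + n1) - neg a) + y * (neg (a + n1 + n2) - neg (a + n2))|
   <= 10 * ((1 - x) * (neg (a + n2) - neg a) +
           x * (neg (a + n1 + n2) - neg (a + n1))).
Proof.
move=> hy hx hn ha hb; apply: bilinear_key_suff => //.
  all: move: hn; rewrite !ler_norml; case: (min0P a) (min0P (a + n1)) (min0P (a + n2))
    (min0P (a + n1 + n2)) => -[? ->] [] [? ->] [] [? ->] [] [? ->];
    case/orP: hb => hb; nra.
Qed.

Lemma bilinear_key_right x y a n1 n2 :
  0 <= y <= 1 -> 4 / 10 <= x <= 1 -> `|n1| <= n2 / 10 ->
  a + n1 <= 0 <= a + n1 + n2 -> (0 <= a) || (a + n2 <= 0) ->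
  `|(1 - y) * (neg (a + n1) - neg a) + y * (neg (a + n1 + n2) - neg (a + n2))|
   <= 10 * ((1 - x) * (neg (a + n2) - neg a) +
           x * (neg (a + n1 + n2) - neg (a + n1))).
Proof.
move=> hy hx hn ha hb; have := @bilinear_key_left (1 - x) y (a + n1) (- n1) n2 hy.
rewrite normrN addrK.
have hx' : 0 <= 1 - x <= 6 / 10 by lra.
move=> /(_ hx' hn ha hb) H; rewrite -normrN.
by congr (`|_| <= _): H; ring.
Qed.

(** The zero line meets both vertical sides, so the horizontal increments are n1 and 0. As a and a +
    n1 are nonpositive, |n1| is at most the larger of the vertical increments -a and -(a + n1), each
    of weight at least 4/10. *)
Lemma bilinear_key_mid x y a n1 n2 :
  0 <= y <= 1 -> 4 / 10 <= x <= 6 / 10 ->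
  a <= 0 <= a + n2 -> a + n1 <= 0 <= a + n1 + n2 -> 
  `|(1 - y) * (neg (a + n1) - neg a) + y * (neg (a + n1 + n2) - neg (a + n2))|
   <= 10 * ((1 - x) * (neg (a + n2) - neg a) +
           x * (neg (a + n1 + n2) - neg (a + n1))).
Proof.
move=> hy hx ha hb; apply: bilinear_key_suff => //.
  all: rewrite !ler_norml; case: (min0P a) (min0P (a + n1)) (min0P (a + n2))
    (min0P (a + n1 + n2)) => -[? ->] [] [? ->] [] [? ->] [] [? ->]; nra.
Qed.

(* (b, c) stands for the edge of the unit square where x (for b = false) or
   y (for b = true) equals c. *)
Definition on_edge (e : bool * bool) x y := (if e.1 then y else x) = e.2%:R.


Lemma bilinear_key_vert x1 y1 x2 y2 x y a n1 n2 (c : bool) (e' : bool * bool) :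
  0 <= y1 <= 1 -> 0 <= x2 <= 1 -> 0 <= y2 <= 1 ->
  0 <= x <= 1 -> 0 <= y <= 1 ->
  (x1, y1) <> (x2, y2) -> (false, c) != e' -> on_edge (false, c) x1 y1 ->
  on_edge e' x2 y2 ->
  a + n1 * x1 + n2 * y1 = 0 -> a + n1 * x2 + n2 * y2 = 0 ->
  `|x - (x1 + x2) / 2| <= 1 / 10 -> 0 < n2 -> `|n1| <= n2 / 10 ->
  `|(1 - y) * (neg (a + n1) - neg a) + y * (neg (a + n1 + n2) - neg (a + n2))|
   <= 10 * ((1 - x) * (neg (a + n2) - neg a) +
           x * (neg (a + n1 + n2) - neg (a + n1))).
Proof.
rewrite /on_edge => hy1 hx2 hy2 hx hy DE ee oe oe' hD hE; rewrite ler_norml => hm n20 hn.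
(* Excludes that both points sit at a common corner of two adjacent edges, where the line need not
   enter the square. *)
have DE' : (x1 < x2 \/ x2 < x1) \/ (y1 < y2 \/ y2 < y1).
  case: (ltgtP x1 x2); try by [left; left|left; right].
  case: (ltgtP y1 y2); try by [right; left|right; right].
  by move=> ey ex; case: DE; rewrite ex ey.
have hn' := hn; rewrite ler_norml in hn'.
case: c e' ee oe oe' => -[[] []] //= _ oe oe'; subst.
- apply: bilinear_key_right => //; [lra|nra|].
  case: (lerP 0 a) => //= a0; case: (lerP 0 n1) DE' => ? [] [] ?; nra.
- apply: bilinear_key_right => //; [lra|nra|].
  case: (lerP 0 a) => //= a0; case: (lerP n1 0) DE' => ? [] [] ?; nra.
- by apply: bilinear_key_mid => //; [lra|nra|nra].
- apply: bilinear_key_left => //; [lra|nra|].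
  case: (lerP 0 (a + n1)) => //= a0; case: (lerP n1 0) DE' => ? [] [] ?; nra.
- apply: bilinear_key_left => //; [lra|nra|].
  case: (lerP 0 (a + n1)) => //= a0; case: (lerP 0 n1) DE' => ? [] [] ?; nra.
- by apply: bilinear_key_mid => //; [lra|nra|nra].
Qed.

Lemma bilinear_key x1 y1 x2 y2 x y a n1 n2 (e e' : bool * bool) :
  0 <= x1 <= 1 -> 0 <= y1 <= 1 -> 0 <= x2 <= 1 -> 0 <= y2 <= 1 ->
  0 <= x <= 1 -> 0 <= y <= 1 ->
  (x1, y1) <> (x2, y2) -> e != e' -> on_edge e x1 y1 -> on_edge e' x2 y2 ->
  a + n1 * x1 + n2 * y1 = 0 -> a + n1 * x2 + n2 * y2 = 0 ->
  `|x - (x1 + x2) / 2| <= 1 / 10 -> 0 < n2 -> `|n1| <= n2 / 10 ->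
  `|(1 - y) * (neg (a + n1) - neg a) + y * (neg (a + n1 + n2) - neg (a + n2))|
   <= 10 * ((1 - x) * (neg (a + n2) - neg a) +
           x * (neg (a + n1 + n2) - neg (a + n1))).
Proof.
move=> hx1 hy1 hx2 hy2 hx hy DE ee oe oe' hD hE hm n20 hn.
case: e ee oe => -[] c ee oe; last by apply: bilinear_key_vert DE ee oe oe' _ _ hm _ _.
case: e' ee oe' => -[] c' ee oe'; last first.
  rewrite (addrC x1) eq_sym in hm ee.
  by apply: bilinear_key_vert (nesym DE) ee oe' oe _ _ hm _ _.
(* Two distinct horizontal edges are impossible: the line would rise by 1 over a run of at most 1
   with slope at most 1/10. *)
rewrite /on_edge /= in oe oe'; move: hn; rewrite ler_norml => hn.
by case: c c' ee oe oe' => -[] // _ /=; nra.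
Qed.
End NegativePart.

Section BilinearFlux.
Variable R : realFieldType.
Implicit Types a b c x y u v p q z : R.
Local Notation neg a := (Num.min a 0).

Lemma on_edge_swap (e : bool * bool) x y :
  on_edge e x y -> on_edge (~~ e.1, e.2) y x.
Proof. by rewrite /on_edge; case: e.1. Qed.

Lemma on_edge_flip (e : bool * bool) x y :
  on_edge e x y -> on_edge (e.1, if e.1 then ~~ e.2 else e.2) x (1 - y).
Proof. by rewrite /on_edge; case: e => -[] [] /= ->; rewrite ?subrr ?subr0. Qed.

(** (x, y) is the middle of the chord moved by w along the normal. Both ordinates are in [0, 1], so
    |w n2| <= 1 and |w n1| <= 1/10: this is the tolerance around the middle in [bilinear_key]. A
    negative n2 is made positive by the reflection y -> 1 - y, which turns a into a + n2. *)
Lemma bilinear_key_abs x1 y1 x2 y2 x y w a n1 n2 (e e' : bool * bool) :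
  0 <= x1 <= 1 -> 0 <= y1 <= 1 -> 0 <= x2 <= 1 -> 0 <= y2 <= 1 ->
  0 <= x <= 1 -> 0 <= y <= 1 ->
  (x1, y1) <> (x2, y2) -> e != e' -> on_edge e x1 y1 -> on_edge e' x2 y2 ->
  a + n1 * x1 + n2 * y1 = 0 -> a + n1 * x2 + n2 * y2 = 0 ->
  x = (x1 + x2) / 2 + w * n1 -> y = (y1 + y2) / 2 + w * n2 ->
  `|n1| <= `|n2| / 10 ->
  `|(1 - y) * (neg (a + n1) - neg a) + y * (neg (a + n1 + n2) - neg (a + n2))|
   <= 10 * `|(1 - x) * (neg (a + n2) - neg a) +
           x * (neg (a + n1 + n2) - neg (a + n1))|.
Proof.
move=> hx1 hy1 hx2 hy2 hx hy DE ee oe oe' hD hE hxw hyw hn.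
have hm : `|x - (x1 + x2) / 2| <= 1 / 10.
  rewrite hxw addrAC subrr add0r normrM.
  apply: le_trans (ler_wpM2l (normr_ge0 _) hn) _.
  rewrite mulrA -normrM ler_pM2r ?invr_gt0 ?ltr0n// ler_norml; lra.
case: (ltgtP 0 n2) => n20.
- rewrite (gtr0_norm n20) in hn.
  by apply: le_trans (bilinear_key _ _ _ _ _ _ DE ee oe oe' hD hE hm n20 hn) _ => //;
    rewrite ler_pM2l ?ltr0n// ler_norm.
- rewrite (ltr0_norm n20) in hn.
  have DE' : (x1, 1 - y1) <> (x2, 1 - y2).
    by case=> ex ey; apply: DE; congr pair => //; lra.
  have ee' : (e.1, if e.1 then ~~ e.2 else e.2) != (e'.1, if e'.1 then ~~ e'.2 else e'.2).
    by case: (e) (e') ee => -[] [] [] [] [].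
  have hy' : 0 <= 1 - y <= 1 by lra.
  have hy1' : 0 <= 1 - y1 <= 1 by lra.
  have hy2' : 0 <= 1 - y2 <= 1 by lra.
  have hD' : a + n2 + n1 * x1 + - n2 * (1 - y1) = 0 by rewrite -hD; ring.
  have hE' : a + n2 + n1 * x2 + - n2 * (1 - y2) = 0 by rewrite -hE; ring.
  have n20' : 0 < - n2 by rewrite oppr_gt0.
  have := bilinear_key hx1 hy1' hx2 hy2' hx hy' DE' ee' (on_edge_flip oe)
    (on_edge_flip oe') hD' hE' hm n20' hn.
  rewrite addrK (addrAC _ n1 (- n2)) addrK (addrAC _ n2 n1) => H.
  rewrite -[X in _ <= _ * X]normrN.
  apply: le_trans (le_trans H _).
    by rewrite le_eqVlt; apply/orP; left; apply/eqP; congr (`|_|); ring.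
  rewrite ler_pM2l ?ltr0n//; apply: le_trans (ler_norm _).
  by rewrite le_eqVlt; apply/orP; left; apply/eqP; ring.
- move: hn; rewrite -n20 normr0 mul0r normr_le0 => /eqP->.
  by rewrite !addr0 !subrr !mulr0 addr0 normr0 mulr0.
Qed.

Lemma normB_le_max u v : 0 <= u * v -> `|u - v| <= Num.max `|u| `|v|.
Proof.
move=> uv; rewrite le_max; apply/orP.
have [u0|u0] := lerP 0 u; have [v0|v0] := lerP 0 v.
- rewrite (ger0_norm u0) (ger0_norm v0) !ler_norml.
  by case: (lerP u v) => ?; [right|left]; lra.
- have -> : u = 0 by nra.
  by right; rewrite sub0r normrN.
- have -> : v = 0 by nra.
  by left; rewrite subr0.
- rewrite (ltr0_norm u0) (ltr0_norm v0) !ler_norml.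
  by case: (lerP u v) => ?; [left|right]; lra.
Qed.

(** (a, b) is a gradient; the tilt adds p (b n1 - a n2) to the flux a n1 + b n2. The products b n1
    and a n2 have the same sign, so their difference is at most the larger one, and a tenth of each
    is below the flux: for |b n1|, either |n1| < 10 |n2| and b n2 dominates, or [H2] applies and a
    n1 dominates. *)
Lemma flux_bound a b n1 n2 p :
  0 <= a * n1 -> 0 <= b * n2 -> `|p| <= 1 / 10 ->
  (`|n1| <= `|n2| / 10 -> `|a| <= 10 * `|b|) ->
  (`|n2| <= `|n1| / 10 -> `|b| <= 10 * `|a|) ->
  0 <= a * (n1 - p * n2) + b * (n2 + p * n1).
Proof.
move=> h1 h2 hp H1 H2.
have e1 : `|a| * `|n1| = a * n1 by rewrite -normrM ger0_norm.
have e2 : `|b| * `|n2| = b * n2 by rewrite -normrM ger0_norm.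
suff : `|p * (b * n1 - a * n2)| <= a * n1 + b * n2 by rewrite ler_norml; lra.
have ge0 := @normr_ge0 _ R.
have bu : 1 / 10 * (`|b| * `|n1|) <= a * n1 + b * n2.
  rewrite -e1 -e2; case: (lerP `|n2| (`|n1| / 10)) => [/H2|] ?;
  have := ge0 a; have := ge0 b; have := ge0 n1; have := ge0 n2; nra.
have av : 1 / 10 * (`|a| * `|n2|) <= a * n1 + b * n2.
  rewrite -e1 -e2; case: (lerP `|n1| (`|n2| / 10)) => [/H1|] ?;
  have := ge0 a; have := ge0 b; have := ge0 n1; have := ge0 n2; nra.
have hM : `|b * n1 - a * n2| <= Num.max (`|b| * `|n1|) (`|a| * `|n2|).
  by rewrite -!normrM; apply: normB_le_max; nra.
rewrite normrM; apply: le_trans (ler_pM _ _ hp hM) _ => //.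
by rewrite maxr_pMr; [rewrite ge_max bu av | lra].
Qed.

Lemma bilinear_flux x1 y1 x2 y2 x y w a n1 n2 p (e e' : bool * bool) :
  0 <= x1 <= 1 -> 0 <= y1 <= 1 -> 0 <= x2 <= 1 -> 0 <= y2 <= 1 ->
  0 <= x <= 1 -> 0 <= y <= 1 ->
  (x1, y1) <> (x2, y2) -> e != e' -> on_edge e x1 y1 -> on_edge e' x2 y2 ->
  a + n1 * x1 + n2 * y1 = 0 -> a + n1 * x2 + n2 * y2 = 0 ->
  x = (x1 + x2) / 2 + w * n1 -> y = (y1 + y2) / 2 + w * n2 ->
  `|p| <= 1 / 10 ->
  0 <= ((1 - y) * (neg (a + n1) - neg a) + y * (neg (a + n1 + n2) - neg (a + n2)))
         * (n1 - p * n2) +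
       ((1 - x) * (neg (a + n2) - neg a) + x * (neg (a + n1 + n2) - neg (a + n1)))
         * (n2 + p * n1).
Proof.
move=> hx1 hy1 hx2 hy2 hx hy DE ee oe oe' hD hE hxw hyw hp.
have := bilinear_key_abs hx1 hy1 hx2 hy2 hx hy DE ee oe oe' hD hE hxw hyw.
have DE' : (y1, x1) <> (y2, x2) by case=> ey ex; apply: DE; rewrite ex ey.
have ee' : (~~ e.1, e.2) != (~~ e'.1, e'.2) by case: (e) (e') ee => -[] [] [] [] [].
have := @bilinear_key_abs y1 x1 y2 x2 y x w a n2 n1 _ _ hy1 hx1 hy2 hx2 hy hx DE' ee'
  (on_edge_swap oe) (on_edge_swap oe').
rewrite ![a + n2 * _ + _]addrAC !(addrAC _ n2 n1) => /(_ hD hE hyw hxw) Ky Kx.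
have W1 : 0 <= (neg (a + n1) - neg a) * n1 by exact: neg_incr_mul.
have W2 : 0 <= (neg (a + n2) - neg a) * n2 by exact: neg_incr_mul.
have W3 : 0 <= (neg (a + n1 + n2) - neg (a + n1)) * n2 by exact: neg_incr_mul.
have W4 : 0 <= (neg (a + n1 + n2) - neg (a + n2)) * n1.
  by rewrite addrAC; exact: neg_incr_mul.
apply: flux_bound => //; nra.
Qed.
End BilinearFlux.

(** * The flux of the rotated-Q1 interpolant of min(L, 0) *)

Section RotatedFlux.
Variable R : realFieldType.
Implicit Types a b c x y u v p q z : R.
Local Notation neg a := (Num.min a 0).

(* rot_d is the coefficient of x^2 - y^2 in the rotated-Q1 interpolant of
   min(z + n1 x + n2 y, 0) on the unit square centred at the origin, and
   rot_flux its derivative at (u, v) in the direction (n1, n2). *)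
Definition rot_d z n1 n2 : R :=
  neg (z + n1 / 2) + neg (z - n1 / 2) - neg (z - n2 / 2) - neg (z + n2 / 2).

(** Concavity of min(., 0) makes its sum over z +- n1/2 at least the sum over the wider pair z +-
    n2/2; the upper bound follows from monotonicity and the Lipschitz constant 1. *)
Lemma rot_d_bound z n1 n2 : 0 <= n1 <= n2 -> 0 <= rot_d z n1 n2 <= (n2 - n1) / 2.
Proof.
rewrite /rot_d => hn; case: (min0P (z + n1 / 2)) => -[? ->];
case: (min0P (z - n1 / 2)) => -[? ->]; case: (min0P (z + n2 / 2)) => -[? ->];
case: (min0P (z - n2 / 2)) => -[? ->]; lra.
Qed.

Definition rot_flux z n1 n2 u v : R :=
  (neg (z + n1 / 2) - neg (z - n1 / 2) + 2 * rot_d z n1 n2 * u) * n1 +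
  (neg (z + n2 / 2) - neg (z - n2 / 2) - 2 * rot_d z n1 n2 * v) * n2.

Lemma rot_flux_ge_pos z n1 n2 u v : 0 <= n1 <= n2 -> -1 <= 2 * u <= 1 ->
  - (n2 - n1) * `|z + n1 * u + n2 * v| <= rot_flux z n1 n2 u v.
Proof.
move=> hn hu; have dP := rot_d_bound z hn.
set om := z + _ + _; rewrite /rot_flux; set d := rot_d z n1 n2 in dP *.
have omP := ler_norm om.
(* The ordinate v is eliminated through om, the value of L at (u, v). What remains is a part
   independent of the point, a term that is nonnegative since 2 u >= -1, and an error 2 d om with 2
   d <= n2 - n1. *)
have -> : (neg (z + n1 / 2) - neg (z - n1 / 2) + 2 * d * u) * n1 +
  (neg (z + n2 / 2) - neg (z - n2 / 2) - 2 * d * v) * n2 =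
  (neg (z + n1 / 2) - neg (z - n1 / 2)) * n1 +
  (neg (z + n2 / 2) - neg (z - n2 / 2)) * n2 + 2 * d * (z - n1)
  + 2 * d * (n1 * (1 + 2 * u)) - 2 * d * om by rewrite /om; ring.
have K : 0 <= (neg (z + n1 / 2) - neg (z - n1 / 2)) * n1 +
  (neg (z + n2 / 2) - neg (z - n2 / 2)) * n2 + 2 * d * (z - n1).
  rewrite /d /rot_d; case: (min0P (z + n1 / 2)) => -[? ->];
  case: (min0P (z - n1 / 2)) => -[? ->]; case: (min0P (z + n2 / 2)) => -[? ->];
  case: (min0P (z - n2 / 2)) => -[? ->]; nra.
have : 0 <= d * (n1 * (1 + 2 * u)) by rewrite mulr_ge0 ?mulr_ge0//; lra.
have := normr_ge0 om; move: `|om| omP => om' omP om'0; nra.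
Qed.

Lemma rot_flux_opp1 z n1 n2 u v : rot_flux z (- n1) n2 (- u) v = rot_flux z n1 n2 u v.
Proof. by rewrite /rot_flux /rot_d mulNr opprK; ring. Qed.

Lemma rot_flux_opp2 z n1 n2 u v : rot_flux z n1 (- n2) u (- v) = rot_flux z n1 n2 u v.
Proof. by rewrite /rot_flux /rot_d mulNr opprK; ring. Qed.

Lemma rot_flux_swap z n1 n2 u v : rot_flux z n2 n1 v u = rot_flux z n1 n2 u v.
Proof. by rewrite /rot_flux /rot_d; ring. Qed.

Lemma rot_flux_ge z n1 n2 u v :
  -1 <= 2 * u <= 1 -> -1 <= 2 * v <= 1 -> `|n1| <= 1 -> `|n2| <= 1 ->
  - `|z + n1 * u + n2 * v| <= rot_flux z n1 n2 u v.
Proof.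
wlog n1_ge0 : n1 u / 0 <= n1.
  move=> H; case: (lerP 0 n1) => [|/ltW n10]; first exact: H.
  move=> hu hv h1 h2; rewrite -rot_flux_opp1 -(mulrNN n1).
  by apply: H; rewrite ?oppr_ge0 ?normrN//; lra.
wlog n2_ge0 : n2 v / 0 <= n2.
  move=> H; case: (lerP 0 n2) => [|/ltW n20]; first exact: H.
  move=> hu hv h1 h2; rewrite -rot_flux_opp2 -(mulrNN n2).
  by apply: H; rewrite ?oppr_ge0 ?normrN//; lra.
wlog n12 : n1 n2 u v n1_ge0 n2_ge0 / n1 <= n2.
  move=> H; case: (lerP n1 n2) => [|/ltW n12]; first exact: H.
  by move=> hu hv h1 h2; rewrite -rot_flux_swap addrAC; apply: H.
move=> hu hv; rewrite (ger0_norm n1_ge0) (ger0_norm n2_ge0) => h1 h2.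
have hn : 0 <= n1 <= n2 by rewrite n1_ge0.
apply: le_trans (@rot_flux_ge_pos z n1 n2 u v hn hu).
by have := normr_ge0 (z + n1 * u + n2 * v); nra.
Qed.

(** Being off the chord costs 3/2 q and the tilt at most 3 q, since both partial derivatives are
    bounded by 1 + 1/2; 5 q rounds up the total. *)
Lemma rot_flux_tilt z n1 n2 u v p q :
  -1 <= 2 * u <= 1 -> -1 <= 2 * v <= 1 -> n1 ^+ 2 + n2 ^+ 2 = 1 ->
  `|p| <= q -> `|z + n1 * u + n2 * v| <= 3 / 2 * q ->
  - 5 * q <=
  (neg (z + n1 / 2) - neg (z - n1 / 2) + 2 * rot_d z n1 n2 * u) * (n1 - p * n2) +
  (neg (z + n2 / 2) - neg (z - n2 / 2) - 2 * rot_d z n1 n2 * v) * (n2 + p * n1).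
Proof.
move=> hu hv hn hp hom.
have h1 : -1 <= n1 <= 1 by nra.
have h2 : -1 <= n2 <= 1 by nra.
have := @rot_flux_ge z n1 n2 u v hu hv; rewrite !ler_norml => /(_ h1 h2).
rewrite /rot_flux.
have hd : -1 <= 2 * rot_d z n1 n2 <= 1.
  rewrite /rot_d; case: (min0P (z + n1 / 2)) => -[? ->];
  case: (min0P (z - n1 / 2)) => -[? ->]; case: (min0P (z + n2 / 2)) => -[? ->];
  case: (min0P (z - n2 / 2)) => -[? ->]; lra.
have hx : -1 <= neg (z + n1 / 2) - neg (z - n1 / 2) <= 1.
  by case: (min0P (z + n1 / 2)) => -[? ->]; case: (min0P (z - n1 / 2)) => -[? ->]; lra.
have hy : -1 <= neg (z + n2 / 2) - neg (z - n2 / 2) <= 1.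
  by case: (min0P (z + n2 / 2)) => -[? ->]; case: (min0P (z - n2 / 2)) => -[? ->]; lra.
set Wx := neg _ - _ + _; set Wy := neg _ - _ - _.
have hWx : - (3 / 2) <= Wx <= 3 / 2 by rewrite /Wx; nra.
have hWy : - (3 / 2) <= Wy <= 3 / 2 by rewrite /Wy; nra.
move: Wx Wy hWx hWy {hx hy hd} => Wx Wy hWx hWy H.
have : `|p * (Wy * n1 - Wx * n2)| <= q * 3.
  by rewrite normrM ler_pM// ler_norml; nra.
by rewrite ler_norml; lra.
Qed.
End RotatedFlux.

(** * Unisolvence on the reference element *)

Definition pgrad (R : realType) (k : fe_kind) (p : poly2 R) (X : R * R) : R * R :=
  match k with
  | Defs.Bilinear => (cx p + deg2 p * X.2, cy p + deg2 p * X.1)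
  | RotatedQ1 => (cx p + 2 * deg2 p * X.1, cy p - 2 * deg2 p * X.2)
  | _ => (cx p, cy p)
  end.

Definition ref_elt (R : realType) (k : fe_kind) (h : R) : elt R k :=
  [ffun i : 'I_(nI k) => ref_vertex h i].

Definition aff (R : realType) (a n1 n2 : R) (X : R * R) : R := a + n1 * X.1 + n2 * X.2.

(** * Vanishing of the jump c for each type of element *)

Section Jump.
Variable R : realType.
Implicit Types (k : fe_kind) (p q h a c z : R).
Local Notation neg a := (Num.min a 0).

(* c is the jump of the normal derivative across the line. *)
Lemma jump_on_line k (v : side -> poly2 R) a n1 n2 : n1 ^+ 2 + n2 ^+ 2 = 1 ->
  (forall X, aff a n1 n2 X = 0 -> peval k (v Minus) X = peval k (v Plus) X) ->
  (rectangular k -> deg2 (v Minus) = deg2 (v Plus)) ->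
  exists c, [/\ c0 (v Minus) = c0 (v Plus) + c * a,
    cx (v Minus) = cx (v Plus) + c * n1 & cy (v Minus) = cy (v Plus) + c * n2].
Proof.
case: (v Minus) (v Plus) => [c0m cxm cym dm] [c0p cxp cyp dp] /= hn hl hd.
exists ((cxm - cxp) * n1 + (cym - cyp) * n2).
have H X : aff a n1 n2 X = 0 -> (c0m - c0p) + (cxm - cxp) * X.1 + (cym - cyp) * X.2 = 0.
  move=> /hl; rewrite /peval /=; move: hd; case: k {hl} => /= hd.
  - lra.
  - by rewrite hd //; lra.
  - lra.
  - by rewrite hd //; lra.
(* The foot of the perpendicular from the origin to the line, and its translate by the unit
   direction (n2, -n1). *)
have H0 := H (- a * n1, - a * n2); have H1 := H (- a * n1 + n2, - a * n2 - n1).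
rewrite /aff /= in H0 H1.
have e0 : a + n1 * (- a * n1) + n2 * (- a * n2) = 0.
  by rewrite -[X in X + _ + _ = _]mulr1 -hn; ring.
have {H0} := H0 e0; have {H1} : (c0m - c0p) + (cxm - cxp) * (- a * n1 + n2) +
    (cym - cyp) * (- a * n2 - n1) = 0 by apply: H1; rewrite -e0; ring.
move=> H1 H0.
have H2 : (cxm - cxp) * n2 - (cym - cyp) * n1 = 0.
  by rewrite -[RHS](subrr 0) -{1}H1 -H0; ring.
split.
- by apply/eqP; rewrite -subr_eq0 -H0; apply/eqP; ring.
- apply/eqP; rewrite -subr_eq0; apply/eqP.
  transitivity (n2 * ((cxm - cxp) * n2 - (cym - cyp) * n1) +
    (cxm - cxp) * (1 - (n1 ^+ 2 + n2 ^+ 2))); first by ring.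
  by rewrite H2 hn subrr !mulr0 addr0.
- apply/eqP; rewrite -subr_eq0; apply/eqP.
  transitivity (- n1 * ((cxm - cxp) * n2 - (cym - cyp) * n1) +
    (cym - cyp) * (1 - (n1 ^+ 2 + n2 ^+ 2))); first by ring.
  by rewrite H2 hn subrr !mulr0 addr0.
Qed.

Lemma jump_eq0 bm bp c S : 0 < bm <= bp -> 0 < bm + (bp - bm) * S ->
  (bp - bm) * (- c * S) = bm * c -> c = 0.
Proof. by move=> hb hS H; nra. Qed.

(** The constant gradient consists of the difference quotients along two perpendicular legs joining
    three nodes; multiplied by the matching component of the normal, each quotient of W is
    nonnegative. *)
Lemma triangle_jump_eq0 n1 n2 h bm bp c cx0 cy0 p0 :
  n1 ^+ 2 + n2 ^+ 2 = 1 -> 0 < h -> 0 < bm <= bp ->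
  cx0 * h = - c * (neg (p0 + n1 * h) - neg p0) ->
  cy0 * h = - c * (neg (p0 + n1 * h + n2 * h) - neg (p0 + n1 * h)) ->
  (bp - bm) * (cx0 * n1 + cy0 * n2) = bm * c -> c = 0.
Proof.
move=> hn h0 hb ex ey ef.
have W1 := neg_incr_mul p0 (n1 * h).
have W2 := neg_incr_mul (p0 + n1 * h) (n2 * h).
set B := _ - neg p0 in ex W1; set C := _ - _ in ey W2.
apply: (@jump_eq0 bm bp c ((B * n1 + C * n2) / h)) => //.
  have : 0 <= (B * n1 + C * n2) / h by rewrite divr_ge0 ?(ltW h0)//; nra.
  nra.
have h_neq0 : h != 0 by rewrite gt_eqF.
rewrite -ef; congr (_ * _).
have -> : cx0 = - c * B / h by rewrite -ex mulfK.
have -> : cy0 = - c * C / h by rewrite -ey mulfK.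
by ring.
Qed.

Lemma bilinear_jump_eq0 a n1 n2 h bm bp c x1 y1 x2 y2 x y w p p00 p10 p01 p11 (e e' : bool * bool) :
  0 < h -> 0 < bm <= bp ->
  0 <= x1 <= h -> 0 <= y1 <= h -> 0 <= x2 <= h -> 0 <= y2 <= h ->
  0 <= x <= h -> 0 <= y <= h ->
  (x1, y1) <> (x2, y2) -> e != e' ->
  on_edge e (x1 / h) (y1 / h) -> on_edge e' (x2 / h) (y2 / h) ->
  a + n1 * x1 + n2 * y1 = 0 -> a + n1 * x2 + n2 * y2 = 0 ->
  x = (x1 + x2) / 2 + w * n1 -> y = (y1 + y2) / 2 + w * n2 ->
  `|p| <= 1 / 10 ->
  p00 = - c * neg a -> p10 = - c * neg (a + n1 * h) ->
  p01 = - c * neg (a + n2 * h) -> p11 = - c * neg (a + n1 * h + n2 * h) ->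
  (bp - bm) * (((h - y) * (p10 - p00) + y * (p11 - p01)) * (n1 - p * n2) +
    ((h - x) * (p01 - p00) + x * (p11 - p10)) * (n2 + p * n1)) = bm * h ^+ 2 * c ->
  c = 0.
Proof.
move=> h0 hb hx1 hy1 hx2 hy2 hx hy DE ee oe oe' hD hE hxw hyw hp e00 e10 e01 e11 ef.
have h_neq0 : h != 0 by rewrite gt_eqF.
have unit z : 0 <= z <= h -> 0 <= z / h <= 1.
  by case/andP=> z0 zh; rewrite divr_ge0 ?(ltW h0)//= ler_pdivrMr// mul1r.
have DE' : (x1 / h, y1 / h) <> (x2 / h, y2 / h).
  by case=> /(divIf h_neq0) ex /(divIf h_neq0) ey; apply: DE; rewrite ex ey.
have hD' : a + (n1 * h) * (x1 / h) + (n2 * h) * (y1 / h) = 0 by rewrite -hD; field.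
have hE' : a + (n1 * h) * (x2 / h) + (n2 * h) * (y2 / h) = 0 by rewrite -hE; field.
(* On the unit square lengths are divided by h and the gradient of L is multiplied by h, hence the
   offset w / h^2. *)
have hx' : x / h = (x1 / h + x2 / h) / 2 + w / h ^+ 2 * (n1 * h).
  by rewrite hxw; field.
have hy' : y / h = (y1 / h + y2 / h) / 2 + w / h ^+ 2 * (n2 * h).
  by rewrite hyw; field.
have := bilinear_flux (unit _ hx1) (unit _ hy1) (unit _ hx2) (unit _ hy2) (unit _ hx)
  (unit _ hy) DE' ee oe oe' hD' hE' hx' hy' hp.
set S := (X in 0 <= X) => S0.
apply: (@jump_eq0 (bm * h ^+ 2) (bp * h ^+ 2) c (S / h ^+ 2)).
- have := exprn_gt0 2 h0; nra.
- have h20 := exprn_gt0 2 h0.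
  have : 0 <= S / h ^+ 2 by apply: divr_ge0 => //; exact: ltW.
  move=> S'0; rewrite -mulrBl ltr_pwDl//; first by rewrite mulr_gt0//; lra.
  by rewrite mulr_ge0// mulr_ge0 ?(ltW h20)//; lra.
- rewrite -ef e00 e10 e01 e11 /S; field.
  exact: h_neq0.
Qed.

(** Coordinates are centred in the square: [cx0], [cy0] are the partial derivatives at the centre, z
    is the value of L there and [d0] is twice the second degree coefficient. The condition on 5 q is
    what keeps bm + (bp - bm) S positive under the bound of [rot_flux_tilt]. *)
Lemma rotated_jump_eq0 z n1 n2 h bm bp c u v p q cx0 cy0 d0 :
  n1 ^+ 2 + n2 ^+ 2 = 1 -> 0 < h -> 0 < bm <= bp ->
  - h <= 2 * u <= h -> - h <= 2 * v <= h ->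
  `|p| <= q -> `|z + n1 * u + n2 * v| <= 3 / 2 * q * h ->
  5 * q * (bp - bm) < bm ->
  cx0 * h = - c * (neg (z + n1 * h / 2) - neg (z - n1 * h / 2)) ->
  cy0 * h = - c * (neg (z + n2 * h / 2) - neg (z - n2 * h / 2)) ->
  d0 * h ^+ 2 = - (2 * c) * (neg (z + n1 * h / 2) + neg (z - n1 * h / 2)
                  - neg (z - n2 * h / 2) - neg (z + n2 * h / 2)) ->
  (bp - bm) * ((cx0 + d0 * u) * (n1 - p * n2) + (cy0 - d0 * v) * (n2 + p * n1))
    = bm * c -> c = 0.
Proof.
move=> hn h0 hb hu hv hp hom hq ecx ecy ed ef.
have h_neq0 : h != 0 by rewrite gt_eqF.
have scale t : - h <= 2 * t <= h -> -1 <= 2 * (t / h) <= 1.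
  by move=> ht; rewrite mulrA ler_pdivlMr// ler_pdivrMr// mulN1r mul1r.
have negh t : neg (z + t * h / 2) = h * neg (z / h + t / 2).
  rewrite minr_pMr ?ltW// mulr0; congr Num.min; by field.
have neghN t : neg (z - t * h / 2) = h * neg (z / h - t / 2).
  by have := negh (- t); rewrite !mulNr.
have hom' : `|z / h + n1 * (u / h) + n2 * (v / h)| <= 3 / 2 * q.
  rewrite -(ler_pM2r h0) -[X in X <= _](_ : `|(z / h + n1 * (u / h) + n2 * (v / h)) * h| = _); last by rewrite normrM (gtr0_norm h0).
  by congr (`|_| <= _): hom; field.
have := rot_flux_tilt (scale _ hu) (scale _ hv) hn hp hom'.
rewrite negh neghN in ecx; rewrite negh neghN in ecy; rewrite !negh !neghN in ed.
set m1 := neg (_ + n1 / 2) in ecx ed *; set m2 := neg (_ - n1 / 2) in ecx ed *.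
set m3 := neg (_ + n2 / 2) in ecy ed *; set m4 := neg (_ - n2 / 2) in ecy ed *.
rewrite /rot_d -/m1 -/m2 -/m3 -/m4; set S := (X in _ <= X) => hS.
apply: (@jump_eq0 bm bp c S) => //; first by nra.
rewrite -ef; congr (_ * _).
have -> : cx0 = - c * (m1 - m2).
  by apply: (mulIf h_neq0); rewrite ecx; ring.
have -> : cy0 = - c * (m3 - m4).
  by apply: (mulIf h_neq0); rewrite ecy; ring.
have -> : d0 = - (2 * c) * (m1 + m2 - m4 - m3) / h.
  by apply: (mulIf h_neq0); apply: (mulIf h_neq0); rewrite -mulrA -expr2 ed; field.
by rewrite /S; field.
Qed.
End Jump.

(* (n1 - p * n2, n2 + p * n1) is, up to a positive factor, the normal of the
   interface at F, a slope p away from the normal (n1, n2) of the chord DE. *)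
Definition ref_condition (R : realType) (k : fe_kind) (h a n1 n2 bm bp p : R)
    (D E F : R * R) : Prop :=
  match k with
  | Defs.Bilinear => `|p| <= 1 / 10 /\
      exists (e e' : bool * bool) (w : R),
        [/\ e != e', on_edge e (D.1 / h) (D.2 / h), on_edge e' (E.1 / h) (E.2 / h)
         & F = 2^-1 *: (D + E) + w *: (n1, n2)]
  | RotatedQ1 => exists q, [/\ `|p| <= q, `|aff a n1 n2 F| <= 3 / 2 * q * h &
      5 * q * (bp - bm) < bm]
  | _ => p = 0
  end.

Definition in_square (R : realType) (h : R) (X : R * R) :=
  0 <= X.1 <= h /\ 0 <= X.2 <= h.

(** * Unisolvence when the sides of the nodes are given by the sign of L *)

Section Reference.
Variable R : realType.
Implicit Types (k : fe_kind) (p q h a c z : R).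
Local Notation neg a := (Num.min a 0).

Definition ref_node k h (j : nat) : R * R :=
  match k, j with
  | Defs.Linear, _ | Defs.Bilinear, _ => ref_vertex h j
  | _, 0 => (h / 2, 0)
  | _, 1 => (h, h / 2)
  | CrouzeixRaviart, _ => (h / 2, h / 2)
  | RotatedQ1, 2 => (h / 2, h)
  | RotatedQ1, _ => (0, h / 2)
  end.

Lemma node_ref k h (j : 'I_(nI k)) : node (ref_elt k h) j = ref_node k h j.
Proof.
have mid x y u v : 2^-1 *: ((x, y) + (u, v)) = ((x + u) / 2, (y + v) / 2) :> R * R.
  by congr pair; rewrite /= mulrC.
have hh : (h + h) / 2 = h by field.
rewrite /node; case: k j => -[[|[|[|[|?]]]] //= ?];
  by rewrite !ffunE /= ?mid ?hh ?addr0 ?add0r ?mul0r.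
Qed.

Lemma ref_unisolvent k (v : side -> poly2 R) h a n1 n2 bm bp p (D E F : R * R)
    (sd : 'I_(nI k) -> side) :
  0 < h -> n1 ^+ 2 + n2 ^+ 2 = 1 -> 0 < bm <= bp ->
  in_square h D -> in_square h E -> in_square h F -> D <> E ->
  aff a n1 n2 D = 0 -> aff a n1 n2 E = 0 ->
  ref_condition k h a n1 n2 bm bp p D E F ->
  (forall X, aff a n1 n2 X = 0 -> peval k (v Minus) X = peval k (v Plus) X) ->
  (rectangular k -> deg2 (v Minus) = deg2 (v Plus)) ->
  bm * dot (pgrad k (v Minus) F) (n1 - p * n2, n2 + p * n1) =
  bp * dot (pgrad k (v Plus) F) (n1 - p * n2, n2 + p * n1) ->
  (forall j, peval k (v (sd j)) (node (ref_elt k h) j) = 0) ->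
  (forall j, sd j = Minus -> aff a n1 n2 (node (ref_elt k h) j) <= 0) ->
  (forall j, sd j = Plus -> 0 <= aff a n1 n2 (node (ref_elt k h) j)) ->
  forall s X, peval k (v s) X = 0.
Proof.
move=> h0 hn hb hD hE hF DE lD lE hc hl hd hf hv hm hp.
have h_neq0 : h != 0 by rewrite gt_eqF.
have [c [e0 ex ey]] := jump_on_line hn hl hd.
have vE X : peval k (v Minus) X = peval k (v Plus) X + c * aff a n1 n2 X.
  rewrite /peval e0 ex ey /aff; case: (k) hd => /= hd; try (rewrite (hd isT)); ring.
have hN j : peval k (v Plus) (node (ref_elt k h) j) =
    - c * neg (aff a n1 n2 (node (ref_elt k h) j)).
  case hsd: (sd j); have := hv j; rewrite hsd.
    by rewrite vE (min_l (hm _ hsd)) mulNr => /eqP; rewrite addr_eq0 => /eqP.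
  by rewrite (min_r (hp _ hsd)) mulr0.
have hF' : (bp - bm) * dot (pgrad k (v Plus) F) (n1 - p * n2, n2 + p * n1) = bm * c.
  rewrite mulrBl -hf -mulrBr; congr (_ * _).
  transitivity (c * (n1 ^+ 2 + n2 ^+ 2)); last by rewrite hn mulr1.
  rewrite /dot /pgrad /=; case: (k) hd => /= hd; try (rewrite (hd isT)); rewrite ex ey; ring.
(* Without a jump both pieces are one polynomial vanishing at all nodes, and the classical
   unisolvence of the element applies. *)
suff c_eq0 : c = 0.
  have vE' s : peval k (v s) =1 peval k (v Plus).
    by case: s => // X; rewrite vE c_eq0 mul0r addr0.
  move=> s X; rewrite {s}vE'.
  have {}hN j : peval k (v Plus) (node (ref_elt k h) j) = 0 by rewrite hN c_eq0 oppr0 mul0r.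
  have {}hN j : (j < nI k)%N -> peval k (v Plus) (ref_node k h j) = 0.
    by move=> jk; rewrite -(hN (Ordinal jk)) node_ref.
  move: (v Plus) hN => q; clear -h0; case: q => q0 qx qy qd.
  have z0 t : t * h = 0 -> t = 0 by move/eqP; rewrite mulf_eq0 (gt_eqF h0) orbF => /eqP.
  case: k X => X hN; have := hN 0%N isT; have := hN 1%N isT; have := hN 2%N isT;
    rewrite /peval /=.
  - move=> H2 H1 H0; have qx0 : qx = 0 by apply/z0; lra.
    have qy0 : qy = 0 by apply/z0; lra.
    by subst; rewrite !mul0r; lra.
  - have := hN 3%N isT; rewrite /peval /= => H3 H2 H1 H0.
    have qd0 : qd = 0 by apply/z0; apply/z0; lra.
    have qx0 : qx = 0 by apply/z0; lra.
    have qy0 : qy = 0 by apply/z0; lra.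
    by subst; rewrite !mul0r; lra.
  - move=> H2 H1 H0; have qx0 : qx = 0 by apply/z0; lra.
    have qy0 : qy = 0 by apply/z0; lra.
    by subst; rewrite !mul0r; lra.
  - have := hN 3%N isT; rewrite /peval /= => H3 H2 H1 H0.
    have qd0 : qd = 0 by apply/z0; apply/z0; lra.
    subst; have qx0 : qx = 0 by apply/z0; lra.
    have qy0 : qy = 0 by apply/z0; lra.
    by subst; rewrite !mul0r; lra.
have {}hN j : (j < nI k)%N -> peval k (v Plus) (ref_node k h j) =
     - c * neg (aff a n1 n2 (ref_node k h j)).
  by move=> jk; rewrite -[j]/(nat_of_ord (Ordinal jk)) -node_ref hN.
move: (v Plus) hN hF' => q; clear vE e0 ex ey hl hd hf hv hm hp.
case: q => q0 qx qy qd.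
case: k sd hc => sd hc hN; rewrite /dot /pgrad /= => hF';
have := hN 2%N isT; have := hN 1%N isT; have := hN 0%N isT; rewrite /peval /aff /=.
- move=> H0 H1 H2; rewrite hc in hF'.
  rewrite !mulr0 !addr0 in H0 H1 H2.
  apply: (@triangle_jump_eq0 _ n1 n2 h bm bp c qx qy a) => //.
  + lra.
  + lra.
  + by rewrite -hF'; ring.
- have := hN 3%N isT; rewrite /peval /aff /= => H3 H0 H1 H2.
  case: hc => hp [e [e' [w [ee oe oe' hFm]]]].
  rewrite !mulr0 !addr0 in H0 H1 H2 H3.
  case: hD hE hF => hD1 hD2 [hE1 hE2] [hF1 hF2].
  apply: (@bilinear_jump_eq0 _ a n1 n2 h bm bp c D.1 D.2 E.1 E.2 F.1 F.2 w p
    q0 (q0 + qx * h) (q0 + qy * h) (q0 + qx * h + qy * h + qd * (h * h)) e e') => //.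
  + by case: (D) (E) DE => ? ? [].
  + by rewrite hFm /= mulrC.
  + by rewrite hFm /= mulrC.
  + lra.
  + have -> : bm * h ^+ 2 * c = bm * c * h ^+ 2 by ring.
    by rewrite -hF'; ring.
- move=> H0 H1 H2; rewrite hc in hF'.
  rewrite !mulr0 !addr0 in H0.
  have e2 : a + n1 * h + n2 * (h / 2) = a + n1 * (h / 2) + n2 * (h / 2) + n1 * (h / 2) by field.
  rewrite e2 in H1.
  (* The midpoints (h/2, 0), (h/2, h/2), (h, h/2) form a right-angled path with legs h/2, the
     vertical leg first: hence the exchanged coordinates. *)
  apply: (@triangle_jump_eq0 _ n2 n1 (h / 2) bm bp c qy qx (a + n1 * (h / 2))) => //.
  + by rewrite addrC.
  + by rewrite divr_gt0.
  + lra.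
  + lra.
  + by rewrite -hF'; ring.
- have := hN 3%N isT; rewrite /peval /aff /= => H3 H0 H1 H2.
  case: hc => q [hp hom hq]; case: hF => hF1 hF2.
  pose z := a + n1 * (h / 2) + n2 * (h / 2).
  have E0 : z - n2 * h / 2 = a + n1 * (h / 2) + n2 * 0 by rewrite /z; field.
  have E1 : z + n1 * h / 2 = a + n1 * h + n2 * (h / 2) by rewrite /z; field.
  have E2 : z + n2 * h / 2 = a + n1 * (h / 2) + n2 * h by rewrite /z; field.
  have E3 : z - n1 * h / 2 = a + n1 * 0 + n2 * (h / 2) by rewrite /z; field.
  apply: (@rotated_jump_eq0 _ z n1 n2 h bm bp c (F.1 - h / 2) (F.2 - h / 2) p q
     (qx + qd * h) (qy - qd * h) (2 * qd)) => //; rewrite ?E0 ?E1 ?E2 ?E3.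
  + lra.
  + lra.
  + by congr (`|_| <= _): hom; rewrite /aff /z; ring.
  + lra.
  + lra.
  + lra.
  + by rewrite -hF'; congr (_ * _); field.
Qed.
End Reference.

(** * Slope and curvature of the interface *)

Section Slope.
Variable R : realType.
Implicit Types (w : R -> R) (t b K : R).

Lemma C2_derivable w t : C2 w -> derivable w t 1.
Proof. by case=> + _ _; exact. Qed.

Lemma C2_derivable1 w t : C2 w -> derivable (derive1 w) t 1.
Proof. by case=> _ + _; exact. Qed.

Lemma derivable_continuous w : (forall t, derivable w t 1) -> continuous w.
Proof. by move=> dw t; exact/differentiable_continuous/derivable1_diffP. Qed.

Lemma C2_continuous w : C2 w -> continuous w.
Proof. by case=> dw _ _; exact: derivable_continuous. Qed.

Lemma is_derive_derive1 w t : derivable w t 1 -> is_derive t 1 w ((derive1 w) t).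
Proof. by move=> dw; rewrite derive1E; exact: derivableP. Qed.

Lemma is_derive_sine_of_slope w t d : is_derive t 1 w d ->
  is_derive t 1 (fun x => w x / Num.sqrt (1 + w x ^+ 2)) (d / Num.sqrt (1 + w t ^+ 2) ^+ 3).
Proof.
move=> dw; have pos : 0 < 1 + w t ^+ 2 by rewrite ltr_wpDr ?sqr_ge0.
have dg : is_derive t 1 (cst 1 + w ^+ 2) (2 * w t * d).
  by apply: is_derive_eq; rewrite /= add0r expr1.
have s0 : Num.sqrt (1 + w t ^+ 2) != 0 by rewrite gt_eqF ?sqrtr_gt0.
have ds : is_derive t 1 (Num.sqrt \o (cst 1 + w ^+ 2))
    ((2 * Num.sqrt (1 + w t ^+ 2))^-1 * (2 * w t * d)).
  exact/is_derive1_comp/is_derive1_sqrt.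
have dv := @is_deriveV R (Num.sqrt \o (cst 1 + w ^+ 2)) t _ 1 s0 ds.
apply: is_derive_eq (is_deriveM dw dv) _.
rewrite /GRing.scale /=; set r := Num.sqrt _ in s0 *.
have sq : r ^+ 2 = 1 + w t ^+ 2 by rewrite sqr_sqrtr// ltW.
have -> : w t * (- r ^- 2 * ((2 * r)^-1 * (2 * w t * d))) + r^-1 * d =
   d * (r ^+ 2 - w t ^+ 2) / r ^+ 3 by field.
by rewrite sq addrK mulr1.
Qed.

(** Rolle gives a point of zero slope; from there the sine of the slope angle varies at rate at most
    K over a distance at most b. *)
Lemma slope_le w b K : 0 < b -> C2 w -> w 0 = w b ->
  (forall t, 0 <= t <= b ->
    `|derive1 (derive1 w) t| <= K * Num.sqrt (1 + (derive1 w t) ^+ 2) ^+ 3) ->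
  forall t, 0 <= t <= b ->
    `|derive1 w t| <= K * b * Num.sqrt (1 + (derive1 w t) ^+ 2).
Proof.
move=> b0 cw w0b hK t /andP[t0 tb].
have wc := C2_continuous cw.
have [c cb dc] : exists2 c, c \in `]0, b[%R & is_derive c 1 w 0.
  by apply: Rolle => //; [move=> x _; exact: C2_derivable|exact: continuous_subspaceT].
have wc0 : derive1 w c = 0 by rewrite derive1E; apply: derive_val.
pose f (x : R) : R := derive1 w x / Num.sqrt (1 + derive1 w x ^+ 2).
pose df (x : R) : R := derive1 (derive1 w) x / Num.sqrt (1 + derive1 w x ^+ 2) ^+ 3.
have fD (x : R) : is_derive x 1 f (df x).
  apply: is_derive_sine_of_slope; apply: is_derive_derive1; exact: C2_derivable1.
have fc : continuous f by apply: derivable_continuous => x; exact: ex_derive.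
have sqp (x : R) : 0 < Num.sqrt (1 + derive1 w x ^+ 2).
  by rewrite sqrtr_gt0 ltr_wpDr ?sqr_ge0.
have dfK (x : R) : 0 <= x <= b -> `|df x| <= K.
  move=> /hK; rewrite /df normrM normfV (gtr0_norm (exprn_gt0 3 (sqp x))).
  by rewrite ler_pdivrMr ?exprn_gt0.
move: cb; rewrite in_itv /= => /andP[c0 cb].
have fc0 : f c = 0 by rewrite /f wc0 mul0r.
have ft : `|f t| <= K * b.
  case: (lerP c t) => ct.
    have [x] := @MVT_segment R f df c t ct (fun x _ => fD x) (continuous_subspaceT fc).
    rewrite in_itv /= fc0 subr0 => /andP[cx xt] ->; rewrite normrM ler_pM//.
      by apply: dfK; lra.
    by rewrite ger0_norm; lra.
  have [x] := @MVT_segment R f df t c (ltW ct) (fun x _ => fD x) (continuous_subspaceT fc).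
  rewrite in_itv /= fc0 sub0r -[`|f t|]normrN => /andP[cx xt] ->; rewrite normrM ler_pM//.
    by apply: dfK; lra.
  by rewrite ger0_norm; lra.
move: ft; rewrite /f normrM normfV (gtr0_norm (sqp t)).
by rewrite ler_pdivrMr.
Qed.
End Slope.

Definition tangent (R : realType) (D E : R * R) : R * R := (enorm (E - D))^-1 *: (E - D).

Section Frame.
Variable R : realType.
Implicit Types (w : R -> R) (D E nb X : R * R).

Lemma enorm_gt0 X : X <> 0 -> 0 < enorm X.
Proof.
case: X => x y X0; rewrite sqrtr_gt0 /dot /=.
rewrite -!expr2 lt_def addr_ge0 ?sqr_ge0// andbT paddr_eq0 ?sqr_ge0//.
by rewrite !sqrf_eq0; apply/negP => /andP[/eqP x0 /eqP y0]; apply: X0; rewrite x0 y0.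
Qed.

Lemma sqr_enorm X : enorm X ^+ 2 = dot X X.
Proof. by rewrite sqr_sqrtr// /dot -!expr2 addr_ge0 ?sqr_ge0. Qed.

Lemma dot_tangent D E : D <> E -> dot (tangent D E) (tangent D E) = 1.
Proof.
move=> DE; have e0 : 0 < enorm (E - D).
  by apply: enorm_gt0 => /eqP; rewrite subr_eq0 => /eqP ED; exact: DE.
have := sqr_enorm (E - D); rewrite /tangent; move: (enorm _) e0 => e e0.
rewrite /dot /= => he; rewrite /GRing.scale /=.
have e1 : e != 0 by rewrite gt_eqF.
apply: (mulIf e1); apply: (mulIf e1); rewrite mul1r -[RHS]expr2 he; field.
exact: e1.
Qed.

Lemma dot_normal_tangent D E nb : dot nb (E - D) = 0 -> dot nb (tangent D E) = 0.
Proof.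
move=> h; rewrite /tangent /dot /= /GRing.scale /=.
by rewrite -[RHS](mulr0 (enorm (E - D))^-1) -h /dot /=; ring.
Qed.

(** s is the determinant of (t, n), of square 1 by Lagrange's identity. The orientation of the frame
    is not prescribed, so this sign has to be carried along. *)
Lemma frame_det (t n : R * R) : dot t t = 1 -> dot n n = 1 -> dot n t = 0 ->
  exists2 s : R, s ^+ 2 = 1 & t = s *: (n.2, - n.1).
Proof.
case: t n => t1 t2 [n1 n2]; rewrite /dot /= => tt nn nt.
exists (t1 * n2 - t2 * n1).
  have -> : 1 = 1 * 1 - 0 ^+ 2 :> R by ring.
  by rewrite -{1}tt -{1}nn -nt; ring.
congr pair; rewrite /GRing.scale /=.
- transitivity (t1 * (n1 * n1 + n2 * n2) - n1 * (n1 * t1 + n2 * t2)); last by ring.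
  by rewrite nn nt; ring.
- transitivity (t2 * (n1 * n1 + n2 * n2) - n2 * (n1 * t1 + n2 * t2)); last by ring.
  by rewrite nn nt; ring.
Qed.

Lemma is_derive_lift w (a u v t : R) d : is_derive t 1 w d ->
  is_derive t 1 (fun x => a + x * u + w x * v) (u + d * v).
Proof.
move=> dw.
have du : is_derive t 1 (fun x : R => x * u) u.
  apply: is_derive_eq (is_deriveM (is_derive_id t 1) (is_derive_cst u t 1)) _.
  by rewrite scaler0 add0r /GRing.scale /= mulr1.
have dv : is_derive t 1 (fun x => w x * v) (d * v).
  apply: is_derive_eq (is_deriveM dw (is_derive_cst v t 1)) _.
  by rewrite scaler0 add0r /GRing.scale /= mulrC.
apply: is_derive_eq (is_deriveD (is_deriveD (is_derive_cst a t 1) du) dv) _.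
by rewrite add0r.
Qed.

Lemma derive1_lift w (a u v : R) : (forall t, derivable w t 1) ->
  derive1 (fun x => a + x * u + w x * v) = (fun x => u + derive1 w x * v).
Proof.
move=> dw; apply/funext => x; rewrite derive1E; apply: derive_val.
exact/is_derive_lift/is_derive_derive1.
Qed.

Lemma derive1_lift0 w (u v : R) : (forall t, derivable w t 1) ->
  derive1 (fun x => u + w x * v) = (fun x => derive1 w x * v).
Proof.
move=> dw; have := derive1_lift u 0 v dw.
under eq_fun do rewrite mulr0 addr0.
by move=> ->; apply/funext => x; rewrite add0r.
Qed.

Lemma C2_lift w (a u v : R) : C2 w -> C2 (fun x => a + x * u + w x * v).
Proof.
case=> d1 d2 c2; split.
- by move=> x; apply: ex_derive; exact/is_derive_lift/is_derive_derive1.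
- rewrite (derive1_lift a u v d1) => x.
  have := is_derive_lift u 0 v (is_derive_derive1 (d2 x)).
  by under eq_fun do rewrite mulr0 addr0; case.
- rewrite (derive1_lift a u v d1) (derive1_lift0 u v d2) => x.
  by apply: cvgM; [exact: c2|exact: cvg_cst].
Qed.

(** The parametrization by the abscissa is itself a [C2_arc] in G: its velocity is tangent + w' nb,
    of norm sqrt(1 + w'^2) >= 1, and its acceleration is w'' nb. *)
Lemma graph_curvature G D E nb w kappa : D <> E ->
  dot nb nb = 1 -> dot nb (E - D) = 0 -> C2 w ->
  [set local_pt D E nb xi (w xi) | xi in `[0, enorm (E - D)]] `<=` G ->
  is_max_curvature G kappa ->
  forall t, 0 <= t <= enorm (E - D) ->
    `|derive1 (derive1 w) t| <= kappa * Num.sqrt (1 + (derive1 w t) ^+ 2) ^+ 3.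
Proof.
move=> DE nn nt cw cG [_ hub] t ht.
have tt := dot_tangent DE; have {}nt := dot_normal_tangent nt.
pose c xi := local_pt D E nb xi (w xi).
have c1 : (fun s => (c s).1) = (fun s => D.1 + s * (tangent D E).1 + w s * nb.1) by [].
have c2 : (fun s => (c s).2) = (fun s => D.2 + s * (tangent D E).2 + w s * nb.2) by [].
have [dw d2w _] := cw.
have vE : velocity c = fun x => ((tangent D E).1 + derive1 w x * nb.1,
    (tangent D E).2 + derive1 w x * nb.2).
  by apply/funext => x; rewrite /velocity c1 c2 !(derive1_lift _ _ _ dw).
have aE : velocity (velocity c) = fun x => (derive1 (derive1 w) x * nb.1,
    derive1 (derive1 w) x * nb.2).
  by apply/funext => x; rewrite vE /velocity /= !(derive1_lift0 _ _ d2w).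
have [c1C c2C] := (C2_lift D.1 (tangent D E).1 nb.1 cw, C2_lift D.2 (tangent D E).2 nb.2 cw).
rewrite -c1 in c1C; rewrite -c2 in c2C; clear c1 c2.
move: (tangent D E) tt nt vE => T tt nt vE.
have [s s2 tE] := frame_det tt nn nt.
have normv x : enorm (velocity c x) = Num.sqrt (1 + derive1 w x ^+ 2).
  rewrite /enorm vE; congr Num.sqrt; move: tt nn nt; rewrite /dot /= => tt nn nt.
  transitivity ((T.1 * T.1 + T.2 * T.2) +
    derive1 w x ^+ 2 * (nb.1 * nb.1 + nb.2 * nb.2) +
    2 * derive1 w x * (nb.1 * T.1 + nb.2 * T.2)); first by ring.
  by rewrite tt nn nt; ring.
have pos x : 0 < Num.sqrt (1 + derive1 w x ^+ 2).
  by rewrite sqrtr_gt0 ltr_wpDr ?sqr_ge0.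
have : curvature c t <= kappa.
  apply: hub; exists c, 0, (enorm (E - D)), t; split => //.
  split.
  - by apply: enorm_gt0 => /eqP; rewrite subr_eq0 => /eqP ED; exact: DE.
  - exact: c1C.
  - exact: c2C.
  - move=> x _; apply/eqP => vx0; have := pos x; rewrite -normv vx0.
    by rewrite /enorm /dot /= !mul0r addr0 sqrtr0 ltxx.
rewrite /curvature normv ler_pdivrMr ?exprn_gt0// aE vE /=.
rewrite tE /GRing.scale /=.
set k := derive1 (derive1 w) t; set p := derive1 w t.
have -> : (s * nb.2 + p * nb.1) * (k * nb.2) - (s * - nb.1 + p * nb.2) * (k * nb.1) =
  s * k * dot nb nb by rewrite /dot; ring.
have s1 : `|s| = 1.
  by apply/eqP; rewrite -(@eqrXn2 _ 2)// real_normK ?num_real// s2 expr1n.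
by rewrite nn mulr1 normrM s1 mul1r.
Qed.
End Frame.

(** * The sides of a graph in a convex polygon *)

Section Topo.
Variable R : realType.
Implicit Types (w : R -> R) (O T : set (R * R)) (X : R * R).

(** The image of the segment is connected, and its part in O1 is open in it and also closed, being
    the part outside O2. *)
Lemma path_in_side O1 O2 (f : R -> R * R) (a b : R) :
  open O1 -> open O2 -> O1 `&` O2 = set0 -> continuous f ->
  (forall s, a <= s <= b -> O1 (f s) \/ O2 (f s)) ->
  forall s s', a <= s <= b -> a <= s' <= b -> O1 (f s) -> O1 (f s').
Proof.
move=> o1 o2 o12 cf hf s s' hs hs' O1s.
have C : connected (f @` `[a, b]).
  apply: connected_continuous_connected; first exact: segment_connected.
  exact: continuous_subspaceT.
have fs t : a <= t <= b -> (f @` `[a, b]) (f t) by move=> ht; exists t; rewrite //= in_itv.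
suff e : (f @` `[a, b]) `&` O1 = f @` `[a, b].
  by have := fs _ hs'; rewrite -e => -[].
apply: C.
- by exists (f s); split => //; exact: fs.
- by exists O1.
- exists (~` O2); first exact: open_closedC.
  apply/seteqP; split => [Y [[t + <-] O1Y]|Y [[t + <-] nO2]]; rewrite /= in_itv /= => ht.
    split; first exact: fs.
    by move=> O2Y; have : (O1 `&` O2) (f t) by []; rewrite o12.
  by split; [exact: fs|case: (hf _ ht)].
Qed.

Lemma continuous_pair (f g : R -> R) : continuous f -> continuous g ->
  continuous (fun s => (f s, g s)).
Proof. by move=> cf cg s; exact: (cvg_pair (cf s) (cg s)). Qed.

Lemma graph_lift w O (a b : R) : continuous w -> open O ->
  (forall x, a <= x <= b -> O (x, w x)) ->
  \forall e \near 0^'+, forall x, a <= x <= b -> O (x, w x + e).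
Proof.
move=> cw oO hO.
have /compact_near_coveringP K := @segment_compact R a b.
have C x : (fun p : R * R => (p.1, w p.1 + p.2)) @ (x, 0) --> (x, w x + 0).
  have C1 : (fun p : R * R => p.1) @ (x, (0 : R)) --> x by exact: cvg_fst.
  have C2 : (fun p : R * R => w p.1 + p.2) @ (x, (0 : R)) --> w x + 0.
    apply: cvgD; last exact: cvg_snd.
    by apply: (cvg_comp (fst : R * R -> R) w); [exact: C1|exact: cw].
  exact: (cvg_pair C1 C2).
have H x : (`[a, b]%classic : set R) x ->
    \forall x' \near x & e \near 0^'+, O (x', w x' + e).
  rewrite /= in_itv /= => /hO Ox.
  have : nbhs (x, w x + 0) O by rewrite addr0; exact: open_nbhs_nbhs.
  move=> /C [[A B] [/= A0 B0] AB]; exists (A, B) => //=.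
  by split => //; exact: cvg_within.
have FF : Filter ((0 : R)^'+) by typeclasses eauto.
have N := K R (0^'+) (fun e x => O (x, w x + e)) FF H.
apply: filterS N => e he x hx; apply: he.
by rewrite /= in_itv.
Qed.

Definition seg X Y (s : R) : R * R := (X.1 + s * (Y.1 - X.1), X.2 + s * (Y.2 - X.2)).

Lemma seg0 X Y : seg X Y 0 = X.
Proof. by case: X => x y; rewrite /seg /= !mul0r !addr0. Qed.

Lemma seg1 X Y : seg X Y 1 = Y.
Proof. by case: X Y => x y [x' y']; rewrite /seg /=; congr pair; ring. Qed.

Lemma continuous_affine (a b : R) : continuous (fun s : R => a + s * b).
Proof.
move=> s; apply: cvgD; first exact: cvg_cst.
by apply: cvgM; [exact: cvg_id|exact: cvg_cst].
Qed.

Lemma continuous_seg X Y : continuous (seg X Y).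
Proof. by apply: continuous_pair; exact: continuous_affine. Qed.

Lemma continuous_aff (a b c : R) : continuous (aff a b c).
Proof.
move=> X; apply: cvgD; first apply: cvgD; first exact: cvg_cst.
  by apply: cvgM; [exact: cvg_cst|exact: cvg_fst].
by apply: cvgM; [exact: cvg_cst|exact: cvg_snd].
Qed.

Lemma aff_seg (a b c : R) X Y s :
  aff a b c (seg X Y s) = (1 - s) * aff a b c X + s * aff a b c Y.
Proof. by rewrite /aff /seg /=; ring. Qed.

Lemma conv_gt0 (s a b : R) : 0 <= s <= 1 -> 0 < a -> 0 < b -> 0 < (1 - s) * a + s * b.
Proof. by move=> /andP[]; rewrite le_eqVlt => /predU1P[<-|s0] s1 a0 b0; nra. Qed.

Section Halfplanes.
Variables (I : finType) (ca cb cc : I -> R).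
Local Notation g i := (aff (ca i) (cb i) (cc i)).

Definition polygon : set (R * R) := [set X | forall i, 0 <= g i X].
Definition open_polygon : set (R * R) := [set X | forall i, 0 < g i X].

Lemma open_open_polygon : open open_polygon.
Proof.
rewrite openE => X Xi; rewrite /interior.
have /filter_forall : forall i, \forall Y \near X, 0 < g i Y.
  by move=> i; exact: (cvgr_gt _ (@continuous_aff _ _ _ X) _ (Xi i)).
exact.
Qed.

Lemma seg_polygon X Y s : polygon X -> polygon Y -> 0 <= s <= 1 -> polygon (seg X Y s).
Proof.
move=> hX hY hs i; rewrite aff_seg addr_ge0// mulr_ge0//; lra.
Qed.

Lemma seg_open_polygon X Y s : polygon X -> open_polygon Y -> 0 < s <= 1 ->
  open_polygon (seg X Y s).
Proof.
move=> hX hY hs i; rewrite aff_seg ltr_wpDl// ?mulr_ge0// ?mulr_gt0//; lra.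
Qed.

Lemma open_polygonW X : open_polygon X -> polygon X.
Proof. by move=> hX i; exact: ltW. Qed.

Lemma seg_open_polygon2 X Y s : open_polygon X -> open_polygon Y -> 0 <= s <= 1 ->
  open_polygon (seg X Y s).
Proof.
move=> hX hY /andP[]; rewrite le_eqVlt => /predU1P[<- _|s0 s1]; first by rewrite seg0.
by apply: seg_open_polygon; rewrite ?s0//; exact: open_polygonW.
Qed.

Section Sides.
Variables (w : R -> R) (L : R) (O1 O2 : set (R * R)).
Hypotheses (w_cont : continuous w) (L_gt0 : 0 < L) (w0 : w 0 = 0) (wL : w L = 0).
Hypotheses (O1_open : open O1) (O2_open : open O2) (O12 : O1 `&` O2 = set0).
Hypothesis graph_in : forall x, 0 <= x <= L -> polygon (x, w x).
Hypothesis graph_bd : forall x i, 0 <= x <= L -> g i (x, w x) = 0 -> x = 0 \/ x = L.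
Hypothesis off_graph : forall X, open_polygon X ->
  ~ (0 <= X.1 <= L /\ X.2 = w X.1) -> O1 X \/ O2 X.

Lemma graph_open x : 0 < x < L -> open_polygon (x, w x).
Proof.
move=> hx i; have hx' : 0 <= x <= L by lra.
rewrite lt_def graph_in// andbT; apply/eqP => /(graph_bd hx'); lra.
Qed.

Lemma vertical_side X y : open_polygon X -> open_polygon (X.1, y) ->
  0 < X.1 < L -> w X.1 < X.2 -> w X.1 < y -> O1 X -> O1 (X.1, y).
Proof.
move=> hX hY hx hX2 hy; rewrite -{1}(seg0 X (X.1, y)) -{2}(seg1 X (X.1, y)).
apply: (path_in_side O1_open O2_open O12 (@continuous_seg X (X.1, y)) (a := 0) (b := 1)).
- move=> s hs; apply: off_graph; first exact: seg_open_polygon2.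
  rewrite /seg /= subrr mulr0 addr0 => -[_ yE].
  have := conv_gt0 hs (_ : 0 < X.2 - w X.1) (_ : 0 < y - w X.1).
  by rewrite !subr_gt0 => /(_ hX2 hy); rewrite -yE; lra.
- by rewrite lexx ler01.
- by rewrite ler01 lexx.
Qed.

(** A path above the graph: from X vertically to a slightly lifted copy of the graph, along this
    copy, and vertically to Y. The lift remains in the open polygon because the graph between its
    ends does. *)
Lemma above_side1 X Y : open_polygon X -> open_polygon Y ->
  0 < X.1 < L -> 0 < Y.1 < L -> w X.1 < X.2 -> w Y.1 < Y.2 -> O1 X -> O1 Y.
Proof.
move=> hX hY hx hy hX2 hY2 O1X.
pose a := Num.min X.1 Y.1; pose b := Num.max X.1 Y.1.
have ab x : a <= x <= b -> open_polygon (x, w x).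
  rewrite ge_min le_max => /andP[ax xb]; apply: graph_open.
  by case/orP: ax; case/orP: xb; lra.
have N := graph_lift w_cont open_open_polygon ab.
have [e [[e0 hex hey] he]] : exists e, [/\ 0 < e, e < X.2 - w X.1 & e < Y.2 - w Y.1] /\
   forall x, a <= x <= b -> open_polygon (x, w x + e).
  have m0 : 0 < Num.min (X.2 - w X.1) (Y.2 - w Y.1) by rewrite lt_min !subr_gt0 hX2.
  near (0 : R)^'+ => e; exists e.
  have em : e < Num.min (X.2 - w X.1) (Y.2 - w Y.1) by near: e; exact: nbhs_right_lt.
  move: em; rewrite lt_min => /andP[eX eY]; split; first split => //.
  by near: e; exact: N.
have Xab : a <= X.1 <= b by rewrite ge_min le_max !lexx.
have Yab : a <= Y.1 <= b by rewrite ge_min le_max !lexx !orbT.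
have {}O1X : O1 (X.1, w X.1 + e) by apply: vertical_side => //; [exact: he|lra].
have {}O1X : O1 (Y.1, w Y.1 + e).
  have cf : continuous (fun x => (x, w x + e)).
    apply: continuous_pair => [x|x]; first exact: cvg_id.
    by apply: cvgD; [exact: w_cont|exact: cvg_cst].
  apply: (path_in_side O1_open O2_open O12 cf _ Xab Yab O1X) => x xab.
  by apply: off_graph; [exact: he|case=> _ /=; lra].
rewrite -[Y]/(Y) [Y]surjective_pairing.
by apply: (@vertical_side (Y.1, w Y.1 + e)) => //=; [exact: he|lra].
Unshelve. all: by end_near.
Qed.

Hypothesis base_in : forall x, 0 <= x <= L -> polygon (x, 0).
Variable X0 : R * R.
Hypotheses (X0_in : open_polygon X0) (X0_between : 0 < X0.1 < L) (X0_above : w X0.1 < X0.2).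
Hypothesis X0_side : O1 X0.

(** Serves points outside the strip over the chord. The segment from X to the far end (e, 0) enters
    the strip at parameter s0, where the graph has height 0 and the segment is still higher. Just
    after s0 it is thus above the graph, where [above_side1] applies, and it has not met the graph
    before. *)
Lemma end_side X (e s0 : R) : open_polygon X -> 0 < X.2 -> 0 <= e <= L -> 0 <= s0 < 1 ->
  w (seg X (e, 0) s0).1 = 0 ->
  (forall s, 0 <= s < s0 -> ~ (0 <= (seg X (e, 0) s).1 <= L)) ->
  (forall s, s0 < s < 1 -> 0 < (seg X (e, 0) s).1 < L) -> O1 X.
Proof.
move=> hX X2 he hs0 ws0 before after.
pose f := seg X (e, 0).
pose k s := (f s).2 - w (f s).1.
have kc : continuous k.
  move=> s; apply: cvgB; first exact: continuous_affine.
  by apply: continuous_comp; [exact: continuous_affine|exact: w_cont].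
have ks0 : 0 < k s0 by rewrite /k ws0 /f /seg /=; nra.
have [d /= d0 kd] : \forall s \near s0, 0 < k s by exact: (cvgr_gt _ (kc s0) _ ks0).
(* Close enough to s0 for k to stay positive up to s1, and below 1 for the segment to stay in the
   open polygon. *)
pose s1 := s0 + Num.min (d / 2) ((1 - s0) / 2).
have m0 : 0 < Num.min (d / 2) ((1 - s0) / 2) by rewrite lt_min !divr_gt0//; lra.
have md : Num.min (d / 2) ((1 - s0) / 2) <= d / 2 by rewrite ge_min lexx.
have ms : Num.min (d / 2) ((1 - s0) / 2) <= (1 - s0) / 2 by rewrite ge_min lexx orbT.
have s01 : s0 < s1 by rewrite /s1; lra.
have s11 : s1 < 1 by rewrite /s1; lra.
have fin s : 0 <= s <= s1 -> open_polygon (f s).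
  move=> hs; rewrite /f (_ : seg _ _ _ = seg (e, 0) X (1 - s)).
    by apply: seg_open_polygon => //; [exact: base_in|lra].
  by rewrite /seg /=; congr pair; ring.
have kpos s : s0 <= s <= s1 -> 0 < k s.
  move=> hs; apply: kd => /=; rewrite distrC ger0_norm; last lra.
  by move: hs; rewrite /s1; lra.
have O1f : O1 (f s1).
  apply: above_side1 X0_side => //; first by apply: fin; lra.
    by apply: after; lra.
  by have := kpos s1; rewrite /k; lra.
rewrite -[X](seg0 X (e, 0)).
apply: (path_in_side O1_open O2_open O12 (@continuous_seg X (e, 0)) (a := 0) (b := s1) _ _ _ O1f).
- move=> s hs; apply: off_graph; first exact: fin.
  move=> [h1 h2]; case: (ltrP s s0) => ss0.
    by apply: (before s) h1; lra.
  by have := kpos s; rewrite /k /f h2; lra.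
- by lra.
- by lra.
Qed.

Lemma above_side2 X : open_polygon X -> 0 < X.2 ->
  ~ (0 <= X.1 <= L /\ X.2 <= w X.1) -> O1 X.
Proof.
move=> hX X2 habove.
case: (lerP X.1 0) => X1.
  have LX : 0 < L - X.1 by have := L_gt0; lra.
  have e0 : (seg X (L, 0) (- X.1 / (L - X.1))).1 = 0 by rewrite /seg /=; field; rewrite gt_eqF.
  (* X is to the left of the strip: aim at the right end and enter at abscissa 0. *)
  apply: (@end_side X L (- X.1 / (L - X.1))) => //.
  - by rewrite lexx ltW.
  - by rewrite ler_pdivlMr// ltr_pdivrMr//; have := L_gt0; lra.
  - by rewrite e0.
  - by move=> s; rewrite ltr_pdivlMr// /seg /= => hs; lra.
  - by move=> s; rewrite ltr_pdivrMr// /seg /= => hs; nra.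
case: (ltrP X.1 L) => XL.
  apply: above_side1 X0_side => //; first by rewrite X1.
  by rewrite ltNge; apply/negP => h; apply: habove; split=> //; lra.
have e0 : (seg X (0, 0) ((X.1 - L) / X.1)).1 = L by rewrite /seg /=; field; rewrite gt_eqF.
apply: (@end_side X 0 ((X.1 - L) / X.1)) => //.
- by rewrite lexx ltW.
- by rewrite ler_pdivlMr// ltr_pdivrMr//; have := L_gt0; lra.
- by rewrite e0.
- by move=> s; rewrite ltr_pdivlMr// /seg /= => hs; lra.
- by move=> s; rewrite ltr_pdivrMr// /seg /= => hs; nra.
Qed.

(* A boundary point above the chord lies above the graph: otherwise it would be
   interior to a vertical segment of the polygon, whose upper end, a point of
   the graph, would then be on the boundary too. *)
Lemma bd_above X i : polygon X -> g i X = 0 -> 0 < X.2 ->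
  ~ (0 <= X.1 <= L /\ X.2 <= w X.1).
Proof.
move=> hX gX X2 [hx hw].
have w_gt0 : 0 < w X.1 by lra.
have s0 : 0 < X.2 / w X.1 <= 1 by rewrite divr_gt0//= ler_pdivrMr// mul1r.
have XE : X = seg (X.1, 0) (X.1, w X.1) (X.2 / w X.1).
  rewrite /seg /= subrr mulr0 addr0 subr0 add0r divfK ?gt_eqF//.
  by rewrite -surjective_pairing.
have : g i (X.1, w X.1) = 0.
  have h : g i (seg (X.1, 0) (X.1, w X.1) (X.2 / w X.1)) = 0 by rewrite -XE.
  rewrite aff_seg in h.
  have g1 := base_in hx i; have g2 := graph_in hx i.
  by move: (X.2 / _) s0 (g i _) (g i _) g1 g2 h => s s0 a b ha hb h; nra.
by move=> /(graph_bd hx)[] e; move: w_gt0; rewrite e ?w0 ?wL ltxx.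
Qed.

(** V is an open neighbourhood of X made of points above the chord and not under the graph. A point
    Y of O2 in V and in the polygon may itself be on the boundary, where [off_graph] says nothing;
    pushed slightly towards X0 it becomes interior, stays in O2 and V, and contradicts
    [above_side2]. *)
Lemma boundary_side X i : polygon X -> g i X = 0 -> 0 < X.2 ->
  ~ closure (polygon `&` O2) X.
Proof.
move=> hX gX X2 clX.
have habove := bd_above hX gX X2.
pose V := [set Y : R * R | 0 < Y.2] `&`
  ([set Y : R * R | Y.1 < 0] `|` [set Y : R * R | L < Y.1] `|` [set Y | w Y.1 < Y.2]).
have VE Y : V Y -> ~ (0 <= Y.1 <= L /\ Y.2 <= w Y.1).
  by move=> [_ [[|]|]] /= h [h1 h2]; lra.
have V_open : open V.
  apply: openI; first exact: (open_comp (fun X _ => cvg_snd) (@open_gt R 0)).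
  apply: openU; first apply: openU.
  - exact: (open_comp (fun X _ => cvg_fst) (@open_lt R 0)).
  - exact: (open_comp (fun X _ => cvg_fst) (@open_gt R L)).
  - pose k (Y : R * R) := Y.2 - w Y.1.
    have kc : continuous k.
      move=> Y; apply: cvgB; first exact: cvg_snd.
      by apply: continuous_comp; [exact: cvg_fst|exact: w_cont].
    rewrite (_ : mkset _ = k @^-1` [set z | 0 < z]); last first.
      by apply/seteqP; split => Y /=; rewrite /k subr_gt0.
    by apply: open_comp; [move=> Y _; exact: kc|exact: open_gt].
have VX : V X.
  split => //=; case: (ltrP X.1 0) => h1; first by left; left.
  case: (ltrP L X.1) => h2; first by left; right.
  right; rewrite ltNge; apply/negP => h3; apply: habove; split => //.
  by rewrite h1.
have [Y [[Yin O2Y] VY]] := clX V (open_nbhs_nbhs (conj V_open VX)).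
have : \forall s \near 0^'+, (O2 `&` V) (seg Y X0 s).
  have W : nbhs (seg Y X0 0) (O2 `&` V).
    by rewrite seg0; apply: open_nbhs_nbhs; split; [exact: openI|split].
  by apply: cvg_within; exact: (continuous_seg W).
move=> N; near (0 : R)^'+ => s.
have [sO2 Vs] : (O2 `&` V) (seg Y X0 s) by near: s; exact: N.
have ins : open_polygon (seg Y X0 s).
  apply: seg_open_polygon => //; apply/andP; split => //.
  by near: s; exact: nbhs_right_le.
have O1s := above_side2 ins Vs.1 (VE _ Vs).
by have : (O1 `&` O2) (seg Y X0 s) by []; rewrite O12.
Unshelve. all: by end_near.
Qed.
End Sides.
End Halfplanes.
End Topo.

(** * Local coordinates along the chord *)

Section LocalCoordinates.
Variable R : realType.
Implicit Types (w : R -> R) (O T : set (R * R)) (X : R * R).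

(** Encoded by reconstruction from three values, which are directly the coefficients that [polygon]
    takes. *)
Definition affine (f : R * R -> R) :=
  forall X, f X = aff (f (0, 0)) (f (1, 0) - f (0, 0)) (f (0, 1) - f (0, 0)) X.

Lemma derivative_lt0_near (k : R -> R) (d : R) : is_derive (0 : R) 1 k d -> k 0 = 0 ->
  d < 0 -> \forall s \near 0^'+, k s < 0.
Proof.
move=> [dk dkE] k0 d0; move: dk; rewrite /derivable => /cvg_ex [l kl].
have lE : l = d by rewrite -dkE; apply/esym/cvg_lim.
have {}kl := cvg_dnbhs_at_right kl; rewrite lE in kl.
have N : \forall s \near (0 : R)^'+, s^-1 *: (k (s%:A + 0) - k 0) < 0.
  exact: (cvgr_lt _ kl _ d0).
near=> s; have s0 : 0 < s by [].
have : s^-1 *: (k (s%:A + 0) - k 0) < 0 by near: s; exact: N.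
by rewrite k0 subr0 addr0 /GRing.scale /= mulr1 pmulr_rlt0 ?invr_gt0.
Unshelve. all: by end_near.
Qed.

(** Along the normal direction c (-w', 1) the height above the graph grows at the initial rate c (1
    + w'^2) > 0. *)
Lemma graph_crossing w (x c : R) : derivable w x 1 -> 0 < c ->
  \forall s \near 0^'+, w (x - s * (c * derive1 w x)) < w x + s * c.
Proof.
move=> dw c0; set p := derive1 w x.
have lin (a t : R) : is_derive t 1 (fun s : R => s * a) a.
  apply: is_derive_eq (is_deriveM (is_derive_id t 1) (is_derive_cst a t 1)) _.
  by rewrite scaler0 add0r /GRing.scale /= mulr1.
have du : is_derive (0 : R) 1 (fun s : R => x - s * (c * p)) (- (c * p)).
  apply: is_derive_eq (is_deriveB (is_derive_cst x (0 : R) 1) (lin _ _)) _.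
  by rewrite sub0r.
have dwx : is_derive ((fun s : R => x - s * (c * p)) 0) 1 w p.
  by rewrite mul0r subr0; exact: is_derive_derive1.
have dv : is_derive (0 : R) 1 (fun s : R => w x + s * c) c.
  apply: is_derive_eq (is_deriveD (is_derive_cst (w x) (0 : R) 1) (lin c _)) _.
  by rewrite add0r.
have dk := is_deriveB (@is_derive1_comp R w (fun s : R => x - s * (c * p)) 0 _ _ dwx du) dv.
have H := derivative_lt0_near dk.
have {H} : \forall s \near 0^'+, w (x - s * (c * p)) - (w x + s * c) < 0.
  apply: H; last by nra.
  by rewrite /= [LHS](_ : _ = w (x - 0 * (c * p)) - (w x + 0 * c))// !mul0r subr0 addr0 subrr.
by apply: filterS => s; rewrite subr_lt0.
Qed.

Definition frame_coord D E n X : R * R := (dot (X - D) (tangent D E), dot (X - D) n).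

Lemma continuous_dot Y n : continuous (fun X => dot (X - Y) n).
Proof.
move=> X; apply: cvgD; apply: cvgM; try exact: cvg_cst.
- by apply: cvgB; [exact: cvg_fst|exact: cvg_cst].
- by apply: cvgB; [exact: cvg_snd|exact: cvg_cst].
Qed.

Lemma continuous_frame_coord D E n : continuous (frame_coord D E n).
Proof.
by move=> X; exact: (cvg_pair (@continuous_dot D (tangent D E) X) (@continuous_dot D n X)).
Qed.

Lemma local_ptE D E n (x y : R) : local_pt D E n x y = D + x *: tangent D E + y *: n.
Proof. by []. Qed.

Lemma continuous_local_pt D E n : continuous (fun Y : R * R => local_pt D E n Y.1 Y.2).
Proof.
move=> Y; apply: cvgD; first apply: cvgD; first exact: cvg_cst.
- by apply: cvgZ; [exact: cvg_fst|exact: cvg_cst].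
- by apply: cvgZ; [exact: cvg_snd|exact: cvg_cst].
Qed.

Section FrameCoord.
Variables D E n : R * R.
Hypotheses (DE : D <> E) (nn : dot n n = 1) (nt : dot n (E - D) = 0).
Local Notation t := (tangent D E).

Lemma local_ptK (x y : R) : frame_coord D E n (local_pt D E n x y) = (x, y).
Proof.
rewrite local_ptE /frame_coord; have tt := dot_tangent DE.
have ntT := dot_normal_tangent nt.
have -> : D + x *: t + y *: n - D = x *: t + y *: n by rewrite -(addrA D) (addrC D) addrK.
move: t tt ntT nn; rewrite /dot.
move=> T tt nt' nn' /=; rewrite /GRing.scale /=; congr pair.
- transitivity (x * (T.1 * T.1 + T.2 * T.2) + y * (n.1 * T.1 + n.2 * T.2)); first by ring.
  by rewrite tt nt' mulr0 addr0 mulr1.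
- transitivity (x * (n.1 * T.1 + n.2 * T.2) + y * (n.1 * n.1 + n.2 * n.2)); first by ring.
  by rewrite nt' nn' mulr0 add0r mulr1.
Qed.

Lemma frame_coordK X : local_pt D E n (frame_coord D E n X).1 (frame_coord D E n X).2 = X.
Proof.
have [s s2 tE] := frame_det (dot_tangent DE) nn (dot_normal_tangent nt).
rewrite local_ptE /frame_coord /= tE; move: nn; rewrite /dot /= => nn'.
case: X D n nn' => [x y] [d e] [a b] /= ab; rewrite /GRing.scale /=.
congr pair; rewrite /= /GRing.scale /=.
- transitivity (d + (x - d) * (s ^+ 2 * (b * b) + a * a) + (y - e) * a * b * (1 - s ^+ 2));
    first by ring.
  by rewrite s2 mul1r [b * b + _]addrC ab; ring.
- transitivity (e + (y - e) * (s ^+ 2 * (a * a) + b * b) + (x - d) * a * b * (1 - s ^+ 2));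
    first by ring.
  by rewrite s2 mul1r ab; ring.
Qed.
End FrameCoord.

End LocalCoordinates.

(** * Boundary points above the chord, in the original coordinates *)

Section ChordSide.
Variable R : realType.
Implicit Types (w : R -> R) (O T : set (R * R)) (X : R * R).

Lemma affine_local_pt (f : R * R -> R) D E n : affine f ->
  affine (fun Y => f (local_pt D E n Y.1 Y.2)).
Proof.
move=> af X; rewrite /= (af (local_pt D E n X.1 X.2)) (af (local_pt D E n 0 0)).
rewrite (af (local_pt D E n 1 0)) (af (local_pt D E n 0 1)) !local_ptE /aff /=.
move: (f (0, 0)) (f (1, 0)) (f (0, 1)) (tangent D E) => f0 f1 f2 T {af}.
by case: X T D n => ? ? [? ?] [? ?] [? ?]; rewrite /GRing.scale /= /GRing.scale /=; ring.
Qed.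

Lemma frame_shift (D T n : R * R) (x y d c p : R) :
  D + x *: T + y *: n + d *: (c *: (n - p *: T)) =
  D + (x - d * (c * p)) *: T + (y + d * c) *: n.
Proof.
case: D T n => ? ? [? ?] [? ?].
by congr pair; rewrite /= /GRing.scale /= /GRing.scale /=; ring.
Qed.

(** This is [boundary_side] transported by the local coordinates. Its base point is [Z0], an
    interface point interior to the element, moved a little along the normal: the orientation of the
    normals puts it in O1 and [graph_crossing] puts it above the graph. *)
Lemma chord_side (I : finType) (f : I -> R * R -> R) (D E n Z0 : R * R) w
    (G O1 O2 : set (R * R)) (c : R) :
  let K := [set X | forall i, 0 <= f i X] in
  (forall i, affine (f i)) ->
  D <> E -> dot n n = 1 -> dot n (E - D) = 0 -> (forall x, derivable w x 1) ->
  G `&` K = [set local_pt D E n xi (w xi) | xi in `[0, enorm (E - D)]] ->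
  (G `&` K) D -> (G `&` K) E -> (exists i, f i D = 0) -> (exists i, f i E = 0) ->
  (forall X i, (G `&` K) X -> f i X = 0 -> X = D \/ X = E) ->
  open O1 -> open O2 -> O1 `&` O2 = set0 ->
  (forall X, (forall i, 0 < f i X) -> ~ G X -> O1 X \/ O2 X) ->
  G Z0 -> (forall i, 0 < f i Z0) -> 0 < c ->
  (\forall d \near 0^'+,
    O1 (Z0 + d *: (c *: (n - derive1 w (local_abscissa D E Z0) *: tangent D E)))) ->
  forall M i, K M -> f i M = 0 -> 0 < dot (M - D) n -> ~ closure (K `&` O2) M.
Proof.
move=> K af DE nn nt dw GK GD GE [iD fD] [iE fE] bd o1 o2 o12 off GZ Zi c0 Zn M i KM fM hM.
pose L := enorm (E - D).
have L0 : 0 < L.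
  by apply: enorm_gt0 => /eqP; rewrite subr_eq0 => /eqP ED; exact: DE.
pose Phi (Y : R * R) := local_pt D E n Y.1 Y.2.
pose Psi := frame_coord D E n.
have PhiK Y : Psi (Phi Y) = Y by rewrite /Psi /Phi local_ptK//; case: Y.
have PsiK X : Phi (Psi X) = X by exact: frame_coordK.
pose g j Y := f j (Phi Y).
pose ca j := g j (0, 0); pose cb j := g j (1, 0) - g j (0, 0).
pose cc j := g j (0, 1) - g j (0, 0).
have gE j Y : aff (ca j) (cb j) (cc j) Y = f j (Phi Y).
  by rewrite -(affine_local_pt D E n (af j)).
have PsiD : Psi D = (0, 0).
  have -> : D = Phi (0, 0) by rewrite /Phi local_ptE !scale0r !addr0.
  exact: PhiK.
have PsiE : Psi E = (L, 0).
  have -> : E = Phi (L, 0).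
    rewrite /Phi local_ptE scale0r addr0 /tangent scalerA divff ?gt_eqF//.
    by rewrite scale1r addrC subrK.
  exact: PhiK.
have GKP X : (G `&` K) X -> exists xi, [/\ 0 <= xi <= L, X = Phi (xi, w xi) & Psi X = (xi, w xi)].
  rewrite GK => -[xi /=]; rewrite in_itv /= => hxi <-; exists xi; split => //.
  exact: (PhiK (xi, w xi)).
have w0 : w 0 = 0.
  by have [xi [_ _]] := GKP _ GD; rewrite PsiD => -[<-].
have wL : w L = 0.
  by have [xi [_ _]] := GKP _ GE; rewrite PsiE => -[<-].
have Gin xi : 0 <= xi <= L -> (G `&` K) (Phi (xi, w xi)).
  by move=> hxi; rewrite GK; exists xi => //=; rewrite in_itv.
have cPhi : continuous Phi by exact: continuous_local_pt.
have cPsi : continuous Psi by exact: continuous_frame_coord.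
have [xi0 [hxi0 ZE PsiZ]] : exists xi, [/\ 0 <= xi <= L, Z0 = Phi (xi, w xi) & Psi Z0 = (xi, w xi)].
  by apply: GKP; split => // j; exact: ltW.
(* The ends of the graph are D and E, which lie on sides of K, whereas [Z0] is interior. *)
have xi0_gt0 : 0 < xi0.
  rewrite lt_def (andP hxi0).1 andbT; apply/eqP => e.
  by move: (Zi iD); rewrite ZE e w0 -PsiD PsiK fD ltxx.
have xi0_ltL : xi0 < L.
  rewrite lt_def (andP hxi0).2 andbT; apply/eqP => e.
  by move: (Zi iE); rewrite ZE -e wL -PsiE PsiK fE ltxx.
have absE : local_abscissa D E Z0 = xi0 by rewrite -[xi0]/((xi0, w xi0).1) -PsiZ.
rewrite absE in Zn; set p := derive1 w xi0 in Zn.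
have ZdE d : Z0 + d *: (c *: (n - p *: tangent D E)) = Phi (xi0 - d * (c * p), w xi0 + d * c).
  by rewrite ZE /Phi /= !local_ptE frame_shift.
have cross := graph_crossing (dw xi0) c0.
pose zeta (d : R) := (xi0 - d * (c * p), w xi0 + d * c).
have [d [dO1 [din dx] dw']] : exists d, [/\ O1 (Phi (zeta d)),
   (forall j, 0 < f j (Phi (zeta d))) /\ 0 < (zeta d).1 < L & w (zeta d).1 < (zeta d).2].
  have czeta : continuous zeta.
    apply: continuous_pair; last exact: continuous_affine.
    move=> x; apply: cvgB; first exact: cvg_cst.
    by apply: cvgM; [exact: cvg_id|exact: cvg_cst].
  have zeta0 : zeta 0 = (xi0, w xi0) by rewrite /zeta !mul0r subr0 addr0.
  have N1 : \forall d \near (0 : R), open_polygon ca cb cc (zeta d).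
    apply: czeta; apply: open_nbhs_nbhs; split; first exact: open_open_polygon.
    by rewrite zeta0 => j; rewrite gE -ZE.
  have c1 : (fun d => (zeta d).1) @ (0 : R) --> xi0.
    rewrite -[X in _ --> X](_ : xi0 - 0 * (c * p) = xi0); last by rewrite mul0r subr0.
    by apply: cvgB; [exact: cvg_cst|apply: cvgM; [exact: cvg_id|exact: cvg_cst]].
  have N2 : \forall d \near (0 : R), 0 < (zeta d).1 := cvgr_gt _ c1 _ xi0_gt0.
  have N3 : \forall d \near (0 : R), (zeta d).1 < L := cvgr_lt _ c1 _ xi0_ltL.
  near (0 : R)^'+ => d; exists d; split.
  - by rewrite -ZdE; near: d; exact: Zn.
  - split; last first.
      by apply/andP; split; near: d; apply: cvg_within; [exact: N2|exact: N3].
    by move=> j; rewrite -gE; move: j; near: d; apply: cvg_within; exact: N1.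
  - by rewrite /zeta /=; near: d; exact: cross.
apply: (contra_not _ (@boundary_side R I ca cb cc w L (Phi @^-1` O1) (Phi @^-1` O2)
  _ L0 w0 wL _ _ _ _ _ _ _ (zeta d) _ dx dw' dO1 (Psi M) i _ _ hM)).
- move=> clM B /cPsi /clM [X [[KX O2X] BX]]; exists (Psi X); split => //.
  split; last by rewrite /= PsiK.
  by move=> j; rewrite gE PsiK; exact: KX.
- by apply: derivable_continuous.
- by apply: open_comp => // X _; exact: cPhi.
- by apply: open_comp => // X _; exact: cPhi.
- by rewrite -preimage_setI o12 preimage_set0.
- by move=> x hx j; rewrite gE; have [_] := Gin x hx; apply.
- move=> x j hx; rewrite gE => /(bd _ _ (Gin x hx)) [] e; [left|right].
  + by have := PhiK (x, w x); rewrite e PsiD => -[].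
  + by have := PhiK (x, w x); rewrite e PsiE => -[].
- move=> X Xi hX; apply: (off (Phi X)) => [j|GX]; first by rewrite -gE.
  apply: hX; have [|xi [hxi _]] := GKP (Phi X).
    by split => // j; rewrite -gE; exact: ltW.
  by rewrite PhiK => ->.
- move=> x /andP[x0 xL].
  have -> : (x, 0) = seg (0, 0) (L, 0) (x / L).
    by rewrite /seg /= !subr0 !add0r mulr0 divfK ?gt_eqF.
  apply: seg_polygon => [j|j|]; first by rewrite gE -PsiD PsiK; exact: GD.2.
    by rewrite gE -PsiE PsiK; exact: GE.2.
  by rewrite divr_ge0 ?(ltW L0)//= ler_pdivrMr// mul1r.
- by move=> j; rewrite gE.
- by move=> j; rewrite gE PsiK.
- by rewrite gE PsiK.
Unshelve. all: by end_near.
Qed.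
End ChordSide.

(** * Pull-back to the reference element *)

Section Pull.
Variable R : realType.
Implicit Types (X Y v : R * R) (k : fe_kind) (h : R) (q : poly2 R).

Lemma is_derive_quadratic (f : R * R -> R) X v (a b : R) :
  (forall s : R, f (s *: v + X) = f X + s * a + s ^+ 2 * b) -> is_derive X v f a.
Proof.
move=> fE.
have C : (fun s : R => s^-1 *: ((f \o shift X) (s *: v) - f X)) @ 0^' --> a.
  have : (fun s : R => a + s * b) @ 0^' --> a.
    rewrite -[X in _ --> X](_ : a + 0 * b = a); last by rewrite mul0r addr0.
    apply: cvg_trans (@continuous_affine R a b 0).
    by apply: cvg_app; exact: nbhs_dnbhs.
  apply: cvg_trans; apply: near_eq_cvg; near=> s.
  have s0 : s != 0 by near: s; exact: nbhs_dnbhs_neq.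
  by rewrite /= fE /GRing.scale /=; field.
split; first by apply/cvg_ex; exists a.
exact: cvg_lim C.
Unshelve. all: by end_near.
Qed.

Lemma grad_peval k q X : grad (peval k q) X = pgrad k q X.
Proof.
have D v b : (forall s : R, peval k q (s *: v + X) =
   peval k q X + s * dot (pgrad k q X) v + s ^+ 2 * b) ->
   'D_v (peval k q) X = dot (pgrad k q X) v.
  by move=> H; have [_ ->] := is_derive_quadratic H.
(* Along the coordinate axes xy has no quadratic part, unlike x^2 - y^2. *)
rewrite /grad (D (1, 0) (if k is RotatedQ1 then deg2 q else 0)); last first.
  move=> s; case: k {D}; rewrite /peval /dot /pgrad /= /GRing.scale /=; ring.
rewrite (D (0, 1) (if k is RotatedQ1 then - deg2 q else 0)); last first.
  move=> s; case: k {D}; rewrite /peval /dot /pgrad /= /GRing.scale /=; ring.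
by rewrite /dot /= !(mulr1, mulr0, addr0, add0r) -surjective_pairing.
Qed.

(** When the coordinates are exchanged, the inverse applies the two signs in exchanged order. *)
Definition iso_inv (sw sx sy : bool) X : R * R :=
  axis_isometry sw (if sw then sy else sx) (if sw then sx else sy) X.

Lemma isoK sw sx sy X : iso_inv sw sx sy (axis_isometry sw sx sy X) = X.
Proof.
by case: X => x y; rewrite /iso_inv /axis_isometry; case: sw sx sy => -[] [];
  rewrite /= ?expr0 ?expr1 ?mulN1r ?mul1r ?opprK.
Qed.

Lemma iso_invK sw sx sy X : axis_isometry sw sx sy (iso_inv sw sx sy X) = X.
Proof.
by case: X => x y; rewrite /iso_inv /axis_isometry; case: sw sx sy => -[] [];
  rewrite /= ?expr0 ?expr1 ?mulN1r ?mul1r ?opprK.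
Qed.

Lemma dot_iso sw sx sy X Y :
  dot (axis_isometry sw sx sy X) (axis_isometry sw sx sy Y) = dot X Y.
Proof.
by case: X Y => x y [x' y']; rewrite /axis_isometry /dot; case: sw sx sy => -[] [] /=; ring.
Qed.

Lemma dot_iso_inv sw sx sy X Y :
  dot (iso_inv sw sx sy X) (iso_inv sw sx sy Y) = dot X Y.
Proof. by rewrite -(dot_iso sw sx sy) !iso_invK. Qed.

Lemma iso_lin sw sx sy (a : R) X Y :
  axis_isometry sw sx sy (a *: X + Y) = a *: axis_isometry sw sx sy X + axis_isometry sw sx sy Y.
Proof.
case: X Y => x y [x' y']; rewrite /axis_isometry; case: sw sx sy => -[] [];
 by congr pair; rewrite /= /GRing.scale /=; ring.
Qed.

Lemma iso_inv_lin sw sx sy (a : R) X Y :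
  iso_inv sw sx sy (a *: X + Y) = a *: iso_inv sw sx sy X + iso_inv sw sx sy Y.
Proof. exact: iso_lin. Qed.

(** A reference element suffices because each space Pi_T is stable under these isometries: xy is
    multiplied by the product of the signs, and x^2 - y^2 changes sign exactly when the coordinates
    are exchanged. *)
Definition pull k P sw sx sy q : poly2 R :=
  let e1 := axis_isometry sw sx sy (1, 0) in
  let e2 := axis_isometry sw sx sy (0, 1) in
  Poly2 (peval k q P) (dot (pgrad k q P) e1) (dot (pgrad k q P) e2)
    (deg2 q * match k with
              | RotatedQ1 => (-1) ^+ sw
              | _ => (-1) ^+ sx * (-1) ^+ sy
              end).

Lemma peval_pull k P sw sx sy q Y :
  peval k (pull k P sw sx sy q) Y = peval k q (P + axis_isometry sw sx sy Y).
Proof.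
case: P Y q => px py [x y] [q0 qx qy qd].
by rewrite /pull /axis_isometry; case: sw sx sy => -[] []; rewrite /= ?expr0 ?expr1;
  case: k; rewrite /peval /pgrad /dot /=; ring.
Qed.

Lemma pgrad_pull k P sw sx sy q Y m :
  dot (pgrad k (pull k P sw sx sy q) Y) m =
  dot (pgrad k q (P + axis_isometry sw sx sy Y)) (axis_isometry sw sx sy m).
Proof.
case: P Y q m => px py [x y] [q0 qx qy qd] [m1 m2].
by rewrite /pull /axis_isometry; case: sw sx sy => -[] []; rewrite /= ?expr0 ?expr1;
  case: k; rewrite /peval /pgrad /dot /=; ring.
Qed.
End Pull.

(** * Elements as intersections of half-planes *)

Section ReferenceSides.
Variable R : realType.
Implicit Types (X Y v : R * R) (k : fe_kind) (h : R) (f : R * R -> R).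

(** Numbered as [edge]: zero on the edge from vertex i to the next one, nonnegative on the element.
    Number 2 is the hypotenuse of a triangle. *)
Definition ref_side k h (i : nat) Y : R :=
  match i with
  | 0 => Y.2
  | 1 => h - Y.1
  | 2 => if rectangular k then h - Y.2 else Y.1 - Y.2
  | _ => Y.1
  end.

Lemma affine_ref_side k h i : affine (ref_side k h i).
Proof.
by move=> X; case: i => [|[|[|i]]]; rewrite /ref_side /aff /=; case: (rectangular k); ring.
Qed.

Lemma affine_sum f (I : finType) (w : I -> R) (A : I -> R * R) : affine f ->
  \sum_i w i = 1 -> f (\sum_i w i *: A i) = \sum_i w i * f (A i).
Proof.
move=> af w1; rewrite af /aff.
have -> : (\sum_i w i *: A i).1 = \sum_i w i * (A i).1.
  by apply: (big_morph fst) => // -[? ?] [? ?].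
have -> : (\sum_i w i *: A i).2 = \sum_i w i * (A i).2.
  by apply: (big_morph snd) => // -[? ?] [? ?].
under [RHS]eq_bigr do rewrite [f (A _)]af /aff.
move: (f (0, 0)) (f (1, 0)) (f (0, 1)) => a b c.
rewrite -[X in X + _ + _]mulr1 -w1 !mulr_sumr -!big_split /=.
by apply: eq_bigr => i _; ring.
Qed.

Lemma ref_side_vertex_ge0 k h (i j : 'I_(nI k)) : 0 < h -> 0 <= ref_side k h i (ref_elt k h j).
Proof.
move=> h0; rewrite ffunE.
by case: k i j => -[[|[|[|[|?]]]] //= ?] [[|[|[|[|?]]]] //= ?]; lra.
Qed.

Lemma ref_side_vertex_eq0 k h (i j : 'I_(nI k)) : j \in pred2 i (ordS i) ->
  ref_side k h i (ref_elt k h j) = 0.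
Proof.
rewrite ffunE inE -!val_eqE.
by case: k i j => -[[|[|[|[|?]]]] //= ?] [[|[|[|[|?]]]] //= ?] _; rewrite ?subrr.
Qed.

Lemma carrier_ref_side k h Y (i : 'I_(nI k)) : 0 < h ->
  carrier (ref_elt k h) Y -> 0 <= ref_side k h i Y.
Proof.
move=> h0 [w [w0 _ w1 ->]]; rewrite (affine_sum _ (affine_ref_side k h i))//.
by apply: sumr_ge0 => j _; rewrite mulr_ge0// ref_side_vertex_ge0.
Qed.

Lemma edge_ref_side k h Y (i : 'I_(nI k)) : edge (ref_elt k h) i Y -> ref_side k h i Y = 0.
Proof.
move=> [w [_ wJ w1 ->]]; rewrite (affine_sum _ (affine_ref_side k h i))//.
apply: big1 => j _; case: (boolP (j \in pred2 i (ordS i))) => jJ.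
  by rewrite ref_side_vertex_eq0// mulr0.
by rewrite wJ// mul0r.
Qed.

(* Barycentric coordinates on a triangle, their bilinear analogue on a square. *)
Definition ref_weight k h (i : nat) Y : R :=
  let x := Y.1 / h in let y := Y.2 / h in
  if rectangular k then
    match i with 0 => (1 - x) * (1 - y) | 1 => x * (1 - y) | 2 => x * y | _ => (1 - x) * y end
  else match i with 0 => 1 - x | 1 => x - y | _ => y end.

(** The explicit weights settle the converse inclusions at once: with all indices J gives the
    element, with two neighbours an edge. *)
Lemma conv_ref k h Y (J : {pred 'I_(nI k)}) : 0 < h ->
  (forall i : 'I_(nI k), 0 <= ref_side k h i Y) ->
  (forall i : 'I_(nI k), i \notin J -> ref_weight k h i Y = 0) -> Defs.conv (ref_elt k h) J Y.
Proof.
move=> h0 hY hJ; exists (fun i => ref_weight k h i Y).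
have h_neq0 : h != 0 by rewrite gt_eqF.
split => //.
- move=> i; have S (j : nat) (jk : (j < nI k)%N) : 0 <= ref_side k h j Y by exact: (hY (Ordinal jk)).
  have dx : (0 <= Y.1 / h) = (0 <= Y.1) by rewrite ler_pdivlMr// mul0r.
  have dy : (0 <= Y.2 / h) = (0 <= Y.2) by rewrite ler_pdivlMr// mul0r.
  have dx1 : (0 <= 1 - Y.1 / h) = (Y.1 <= h) by rewrite subr_ge0 ler_pdivrMr// mul1r.
  have dy1 : (0 <= 1 - Y.2 / h) = (Y.2 <= h) by rewrite subr_ge0 ler_pdivrMr// mul1r.
  have dxy : (0 <= Y.1 / h - Y.2 / h) = (Y.2 <= Y.1) by rewrite -mulrBl ler_pdivlMr// mul0r subr_ge0.
  have := S 0%N; have := S 1%N; have := S 2%N; have := S 3%N.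
  rewrite /ref_weight /ref_side; move: (Y.1 / h) (Y.2 / h) dx dy dx1 dy1 dxy => x y dx dy dx1 dy1 dxy.
  clear S hY hJ J; case: k i => -[[|[|[|[|i]]]] //= _] s3 s2 s1 s0;
    rewrite ?mulr_ge0 ?(dx, dy, dx1, dy1, dxy)//;
    have := s0 isT; have := s1 isT; have := s2 isT; try (have := s3 isT); lra.
- rewrite /ref_weight; clear hY hJ J; case: k => /=; rewrite !big_ord_recl big_ord0 /=; ring.
- rewrite /ref_weight; clear hY hJ J; case: Y => x y; case: k => /=;
  rewrite !big_ord_recl big_ord0 !ffunE /=; congr pair; rewrite /= /GRing.scale /=; by field.
Qed.

Lemma ref_side_carrier k h Y : 0 < h ->
  (forall i : 'I_(nI k), 0 <= ref_side k h i Y) -> carrier (ref_elt k h) Y.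
Proof. by move=> h0 hY; apply: conv_ref. Qed.

Lemma ref_side_edge k h Y (i : 'I_(nI k)) : 0 < h ->
  (forall i : 'I_(nI k), 0 <= ref_side k h i Y) -> ref_side k h i Y = 0 ->
  edge (ref_elt k h) i Y.
Proof.
move=> h0 hY hi; apply: conv_ref => // j; move: hi; rewrite inE -!val_eqE.
have h_neq0 : h != 0 by rewrite gt_eqF.
rewrite /ref_side /ref_weight; clear hY.
by case: k i j => -[[|[|[|[|i]]]] //= _] [[|[|[|[|j]]]] //= _];
  first [ by move=> -> ; rewrite ?mul0r ?subr0 ?mulr0
  | by move=> /subr0_eq <-; rewrite ?divff ?subrr ?mul0r ?mulr0 ].
Qed.
End ReferenceSides.

(** * Sides, interior and nodes of a general element *)

Section ElementSides.
Variable R : realType.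
Implicit Types (k : fe_kind) (h : R).
Implicit Types (X Y v : R * R) (f : R * R -> R).

Section Affine.
Variables (I : finType) (f : I -> R * R -> R).
Hypothesis af : forall i, affine (f i).

Lemma affine_openE : [set X | forall i, 0 < f i X] =
  open_polygon (fun i => f i (0, 0)) (fun i => f i (1, 0) - f i (0, 0))
    (fun i => f i (0, 1) - f i (0, 0)).
Proof. by apply/seteqP; split => X hX i; have := hX i; rewrite /= [f i X]af. Qed.

Lemma affine_seg g X Y s : affine g -> g (seg X Y s) = (1 - s) * g X + s * g Y.
Proof. by move=> ag; rewrite [LHS]ag [g X]ag [g Y]ag aff_seg. Qed.

Lemma affine_interior (C : set (R * R)) : C = [set X | forall i, 0 <= f i X] ->
  (forall i, exists Y, 0 < f i Y) -> C° = [set X | forall i, 0 < f i X].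
Proof.
move=> CE fY; apply/seteqP; split => [X CX i|X hX].
  have [Y fiY] := fY i; rewrite lt_def.
  have CX' : C X by exact: interior_subset.
  have fX0 : 0 <= f i X by move: CX'; rewrite CE; apply.
  rewrite fX0 andbT; apply/eqP => fX.
  (* An interior point can be moved slightly away from Y, where f i is positive; if f i X = 0 this
     makes f i negative. *)
  have N : \forall s \near (0 : R)^'+, C (seg X Y (- s)).
    have c : continuous (fun s : R => seg X Y (- s)).
      by move=> s; apply: continuous_comp; [exact: cvgN|exact: continuous_seg].
    apply: cvg_within; apply: (c 0).
    by rewrite oppr0 seg0.
  near (0 : R)^'+ => s.
  have s0 : 0 < s by [].
  have : C (seg X Y (- s)) by near: s; exact: N.
  rewrite CE => /(_ i); rewrite affine_seg// fX; nra.
have : open [set X | forall i, 0 < f i X] by rewrite affine_openE; exact: open_open_polygon.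
rewrite openE => /(_ _ hX); apply: interiorS => Y hY.
by rewrite CE => i; exact: ltW.
Unshelve. all: by end_near.
Qed.
End Affine.

Lemma ref_node_side_ge0 k h (i j : 'I_(nI k)) : 0 < h -> 0 <= ref_side k h i (ref_node k h j).
Proof.
move=> h0; case: k i j => -[[|[|[|[|i]]]] //= _] [[|[|[|[|j]]]] //= _];
  rewrite /ref_side /=; lra.
Qed.

Lemma ref_node_side_eq0 k h (j : 'I_(nI k)) :
  exists i : 'I_(nI k), ref_side k h i (ref_node k h j) = 0.
Proof. by exists j; case: k j => -[[|[|[|[|j]]]] //= ?]; rewrite /ref_side /= ?subrr. Qed.

Section General.
Variables (k : fe_kind) (h : R) (A : elt R k) (P : R * R) (sw sx sy : bool).
Hypotheses (h0 : 0 < h).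
Hypothesis AE : forall i, A i = P + axis_isometry sw sx sy (ref_vertex h i).
Local Notation iso := (axis_isometry sw sx sy).

Definition ref_coord X : R * R := iso_inv sw sx sy (X - P).
Definition elt_side (i : nat) X : R := ref_side k h i (ref_coord X).

Lemma ref_coordK X : P + iso (ref_coord X) = X.
Proof. by rewrite /ref_coord iso_invK addrC subrK. Qed.

Lemma ref_coord_iso Y : ref_coord (P + iso Y) = Y.
Proof. by rewrite /ref_coord addrC addKr isoK. Qed.

Lemma iso_sum (w : 'I_(nI k) -> R) (B : 'I_(nI k) -> R * R) :
  iso (\sum_i w i *: B i) = \sum_i w i *: iso (B i).
Proof.
have iso0 : iso (0 : R * R) = 0.
  have E := iso_lin sw sx sy (-1) 0 (0 : R * R).
  rewrite scaler0 add0r scaleN1r addNr in E. exact: E.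
apply: (big_ind2 (fun X Y => iso X = Y)) => //.
- by move=> X X' Y Y' <- <-; have := iso_lin sw sx sy 1 X Y; rewrite !scale1r.
- by move=> i _; have := iso_lin sw sx sy (w i) (B i) 0; rewrite iso0 !addr0.
Qed.

Lemma conv_ref_coord (J : {pred 'I_(nI k)}) X :
  Defs.conv A J X <-> Defs.conv (ref_elt k h) J (ref_coord X).
Proof.
have E (w : 'I_(nI k) -> R) : \sum_i w i = 1 ->
    \sum_i w i *: A i = P + iso (\sum_i w i *: ref_elt k h i).
  move=> w1; rewrite iso_sum -[P in RHS]scale1r -w1 scaler_suml -big_split /=.
  by apply: eq_bigr => i _; rewrite AE ffunE scalerDr.
split=> -[w [w0 wJ w1 XE]]; exists w; split => //.
- by rewrite XE E// ref_coord_iso.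
- by rewrite E// -XE ref_coordK.
Qed.

Lemma affine_elt_side i : affine (elt_side i).
Proof.
move=> X; rewrite /elt_side !(affine_ref_side k h i (ref_coord _)) /aff.
move: (ref_side k h i (0, 0)) (ref_side k h i (1, 0)) (ref_side k h i (0, 1)) => a b c.
by case: X P => x y [px py]; rewrite /ref_coord /iso_inv /axis_isometry;
  case: sw sx sy => -[] [] /=; ring.
Qed.

Lemma carrierE : carrier A = [set X | forall i : 'I_(nI k), 0 <= elt_side i X].
Proof.
apply/seteqP; split => X.
  by move=> /conv_ref_coord cX i; exact: carrier_ref_side.
by move=> hX; apply/conv_ref_coord; exact: ref_side_carrier.
Qed.

Lemma edgeE (i : 'I_(nI k)) X : edge A i X <-> carrier A X /\ elt_side i X = 0.
Proof.
split.
  move=> /conv_ref_coord eX; split; last exact: edge_ref_side.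
  apply/conv_ref_coord; case: eX => w [w0 wJ w1 XE]; exists w; split => // j.
move=> [cX eX]; apply/conv_ref_coord; apply: ref_side_edge => //.
by move: cX; rewrite carrierE.
Qed.

Lemma interior_carrierE : (carrier A)° = [set X | forall i : 'I_(nI k), 0 < elt_side i X].
Proof.
apply: affine_interior => [i||i]; [exact: affine_elt_side|exact: carrierE|].
(* Each point gives the value 1 to its side function; it may lie outside the element. *)
pose Y : R * R := match nat_of_ord i with 0 => (0, 1) | 1 => (h - 1, 0)
   | 2 => if rectangular k then (0, h - 1) else (1, 0) | _ => (1, 0) end.
exists (P + iso Y); rewrite /elt_side ref_coord_iso /Y /ref_side.
by case: (nat_of_ord i) => [|[|[|]]] //=; try case: (rectangular k) => /=; lra.
Qed.

Lemma nodeE (j : 'I_(nI k)) : node A j = P + iso (node (ref_elt k h) j).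
Proof.
have half X Y : 2^-1 *: (P + iso X + (P + iso Y)) = P + iso (2^-1 *: (X + Y)).
  case: X Y P => ? ? [? ?] [? ?]; rewrite /axis_isometry.
  by case: sw sx sy => -[] [] /=; congr pair; rewrite /= /GRing.scale /=; field.
by rewrite /node; case: k A AE j => B BE j; rewrite !BE !ffunE ?half.
Qed.

Lemma node_boundary (j : 'I_(nI k)) : exists2 i : 'I_(nI k),
  carrier A (node A j) & elt_side i (node A j) = 0.
Proof.
have [i hi] := ref_node_side_eq0 h j; exists i.
  rewrite carrierE => i'; rewrite /elt_side nodeE ref_coord_iso node_ref.
  exact: ref_node_side_ge0.
by rewrite /elt_side nodeE ref_coord_iso node_ref.
Qed.
End General.
End ElementSides.

(** * Bounds from the unisolvence conditions *)

Section Unisolvence.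
Variable R : realType.
Implicit Types (h kappa eps kbar rho L p : R) (k : fe_kind).

Lemma powRN_ge1 (x r : R) : 0 < x <= 1 -> 0 <= r -> 1 <= x `^ (- r).
Proof.
move=> /andP[x0 x1] r0; rewrite powRN invf_ge1 ?powR_gt0//.
have e1 : 1 `^ r = 1 :> R by rewrite powR1.
by rewrite -[leRHS]e1; apply: ge0_ler_powR; rewrite ?nnegrE ?ler01 ?(ltW x0).
Qed.

Lemma curvature_chord k h kappa eps kbar rho L :
  unisolvence_conditions k h kappa eps kbar rho -> 0 < h -> 0 <= kappa ->
  L ^+ 2 <= 2 * h ^+ 2 -> 4 * (kappa * L) ^+ 2 <= kbar.
Proof.
move=> [/andP[e0 e1] /andP[kb0 kb1] hh _] h0; rewrite le_eqVlt => /predU1P[<-|k0] hL.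
  by rewrite mul0r expr0n mulr0 ltW.
have {hh} := hh k0; rewrite lt_min => /andP[+ _].
have s20 : 0 < Num.sqrt 2 :> R by rewrite sqrtr_gt0.
have s2 : Num.sqrt 2 ^+ 2 = 2 :> R by rewrite sqr_sqrtr.
have skb : Num.sqrt kbar ^+ 2 = kbar by rewrite sqr_sqrtr// ltW.
have skb0 : 0 < Num.sqrt kbar by rewrite sqrtr_gt0.
(* Then the bound on h implies 2 sqrt 2 h kappa <= sqrt kbar, and L <= sqrt 2 h. *)
have B1 : 1 <= (1 - 2 * eps ^+ 2) `^ (- (3 / 2)).
  apply: powRN_ge1; last lra.
  by apply/andP; split; nra.
move: (_ `^ _) B1 => B B1.
rewrite ltr_pdivlMr ?mulr_gt0//; last lra.
move: (Num.sqrt 2) s20 s2 (Num.sqrt kbar) skb skb0 => t t0 t2 r r2 r0 hr.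
have hr2 : 2 * (h * t * kappa) <= r.
  have : 0 <= h * t * kappa by rewrite !mulr_ge0// ltW.
  have {hr} : h * t * kappa * (1 + B) < r by congr (_ < _): hr; ring.
  move: (h * t * kappa) => z; nra.
have hr3 : 4 * (h * t * kappa) ^+ 2 <= kbar.
  have : 0 <= h * t * kappa by rewrite !mulr_ge0// ltW.
  by rewrite -r2; move: (h * t * kappa) hr2 => z; nra.
apply: le_trans hr3; rewrite ler_pM2l// !exprMn t2 [in leRHS]mulrC.
by rewrite ler_pM2l ?exprn_gt0// [leRHS]mulrC.
Qed.

Lemma slope_of_sine_le kbar K p : 0 <= K -> 4 * K ^+ 2 <= kbar ->
  `|p| <= K * Num.sqrt (1 + p ^+ 2) -> (4 - kbar) * p ^+ 2 <= kbar.
Proof.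
move=> K0 hK hp.
have : `|p| ^+ 2 <= (K * Num.sqrt (1 + p ^+ 2)) ^+ 2 by rewrite lerXn2r ?nnegrE// mulr_ge0.
rewrite real_normK ?num_real// exprMn sqr_sqrtr; last by rewrite addr_ge0 ?sqr_ge0.
have := sqr_ge0 p; nra.
Qed.

(** Here kbar < 1/32, so p^2 <= kbar / (4 - kbar) <= 1/127 < 1/100. *)
Lemma slope_bilinear kbar p : 0 < kbar -> Num.sqrt kbar < 1 / (4 * Num.sqrt 2) ->
  (4 - kbar) * p ^+ 2 <= kbar -> `|p| <= 1 / 10.
Proof.
move=> k0 hk hp.
have s20 : 0 < Num.sqrt 2 :> R by rewrite sqrtr_gt0.
have s2 : Num.sqrt 2 ^+ 2 = 2 :> R by rewrite sqr_sqrtr.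
have skb : Num.sqrt kbar ^+ 2 = kbar by rewrite sqr_sqrtr// ltW.
have skb0 : 0 < Num.sqrt kbar by rewrite sqrtr_gt0.
move: hk; rewrite ltr_pdivlMr ?mulr_gt0// => hk.
have k32 : kbar * 32 <= 1.
  have : (Num.sqrt kbar * (4 * Num.sqrt 2)) ^+ 2 <= 1.
    by rewrite exprn_ile1 ?(ltW hk)// !mulr_ge0 ?ltW.
  by rewrite !exprMn skb s2; lra.
rewrite -(@ler_pXn2r _ 2) ?nnegrE ?divr_ge0//.
rewrite real_normK ?num_real//.
have : 0 <= p ^+ 2 * (1 - kbar * 32) by rewrite mulr_ge0 ?sqr_ge0//; lra.
by move: (p ^+ 2) hp => P hP; rewrite mulrBr; lra.
Qed.

Lemma slope_rotated kbar bm bp : 0 < bm <= bp -> 0 < kbar <= 1 ->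
  (exists2 lam : R, 0 < lam < 1 & Num.sqrt kbar <=
      (bm / bp) * (1 - lam) / (4 - (3 + lam) * (bm / bp))) ->
  (forall p : R, (4 - kbar) * p ^+ 2 <= kbar -> `|p| <= 3 / 5 * Num.sqrt kbar) /\
  5 * (3 / 5 * Num.sqrt kbar) * (bp - bm) < bm.
Proof.
move=> hb /andP[k0 k1] [lam hl].
have skb : Num.sqrt kbar ^+ 2 = kbar by rewrite sqr_sqrtr// ltW.
have skb0 : 0 < Num.sqrt kbar by rewrite sqrtr_gt0.
have bp0 : 0 < bp by lra.
have rhoE : bm / bp * bp = bm by rewrite divfK ?gt_eqF.
have rho0 : 0 < bm / bp by rewrite divr_gt0//; lra.
have rho1 : bm / bp <= 1 by rewrite ler_pdivrMr// mul1r; lra.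
move: (bm / bp) rhoE rho0 rho1 => rho rhoE rho0 rho1.
rewrite ler_pdivlMr; last by nra.
move: (Num.sqrt kbar) skb skb0 => r r2 r0 hr; split.
  (* As kbar <= 1, q^2 <= kbar / 3 <= (9/25) kbar; with this constant 5 times the slope bound is 3
     sqrt kbar. *)
  move=> q hq; rewrite -(@ler_pXn2r _ 2) ?nnegrE ?mulr_ge0 ?divr_ge0 ?(ltW r0)//.
  rewrite real_normK ?num_real//.
  have : 0 <= q ^+ 2 * (1 - kbar) by rewrite mulr_ge0 ?sqr_ge0//; lra.
  have := sqr_ge0 q; move: (q ^+ 2) hq => Q hQ; rewrite exprMn r2 mulrBr; lra.
(* lam is eliminated through 4 - (3 + lam) rho = (1 - lam) (4 - 3 rho) + 4 lam (1 - rho). Since 4 -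
   3 rho = 3 (1 - rho) + 1 and r > 0, this gives 3 r (1 - rho) < rho. *)
have h1 : r * (4 - 3 * rho) <= rho.
  have : r * (4 - 3 * rho) * (1 - lam) <= rho * (1 - lam).
    apply: le_trans hr; have : 0 <= r * (lam * (1 - rho)) by rewrite !mulr_ge0//; lra.
    lra.
  by rewrite ler_pM2r//; lra.
rewrite -rhoE; have : 3 * r * (1 - rho) < rho by nra.
nra.
Qed.
End Unisolvence.

(** * Nodes on either side of the chord *)

Section Nodes.
Variable R : realType.

Lemma node_above (k : fe_kind) (G : set (R * R)) (h : R) (T : elt R k)
    (P : R * R) (sw sx sy : bool) (D E n : R * R) (w : R -> R) (O1 O2 : set (R * R)) :
  0 < h -> (forall i, T i = P + axis_isometry sw sx sy (ref_vertex h i)) ->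
  open O1 -> open O2 -> O1 `&` O2 = set0 ->
  (forall X, (carrier T)° X -> ~ G X -> O1 X \/ O2 X) ->
  (carrier T)° `&` G !=set0 ->
  D <> E -> G `&` boundary T = [set D; E] ->
  dot n n = 1 -> dot n (E - D) = 0 -> (forall x, derivable w x 1) ->
  G `&` carrier T = [set local_pt D E n xi (w xi) | xi in `[0, enorm (E - D)]] ->
  (forall X, G X -> (carrier T)° X ->
    \forall d \near (0 : R)^'+, O1 (X + d *: interface_normal D E n w X)) ->
  forall j, 0 < dot (node T j - D) n -> ~ closure (carrier T `&` O2) (node T j).
Proof.
move=> h0 TE o1 o2 o12 off [Z0 [ZT GZ]] DE GB nn nt dw GT nrm j hj.
have TK := carrierE h0 TE; have TiK := interior_carrierE h0 TE.
pose f (i : 'I_(nI k)) := elt_side k h P sw sx sy i.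
have bdP X : boundary T X -> carrier T X /\ exists i, f i X = 0.
  by move=> [i _ /(edgeE h0 TE)[cX fX]]; split => //; exists i.
have GBD : (G `&` boundary T) D by rewrite GB; left.
have GBE : (G `&` boundary T) E by rewrite GB; right.
have [i cM fM] := node_boundary h0 TE j.
rewrite TK; apply: (@chord_side R _ f D E n Z0 w G O1 O2
  (Num.sqrt (1 + derive1 w (local_abscissa D E Z0) ^+ 2))^-1
  _ DE nn nt dw _ _ _ _ _ _ o1 o2 o12 _ GZ _ _ _ (node T j) i _ fM hj); rewrite -?TK//.
- by move=> i'; exact: affine_elt_side.
- by split; [exact: GBD.1|exact: (bdP _ GBD.2).1].
- by split; [exact: GBE.1|exact: (bdP _ GBE.2).1].
- exact: (bdP _ GBD.2).2.
- exact: (bdP _ GBE.2).2.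
- move=> X i' [GX TX] fX.
  have : (G `&` boundary T) X by split => //; exists i' => //; apply/(edgeE h0 TE).
  by rewrite GB.
- by move=> X fX; apply: off; rewrite TiK.
- by move: ZT; rewrite TiK.
- by rewrite invr_gt0 sqrtr_gt0 ltr_wpDr ?sqr_ge0.
- exact: nrm.
Qed.

Lemma local_pt_opp D E n (xi y : R) : local_pt D E (- n) xi (- y) = local_pt D E n xi y.
Proof. by rewrite /local_pt scaleNr scalerN opprK. Qed.

Lemma interface_normal_opp D E n (w : R -> R) (X : R * R) : (forall x, derivable w x 1) ->
  interface_normal D E (- n) (fun x => - w x) X = - interface_normal D E n w X.
Proof.
move=> dw; rewrite /interface_normal.
have -> : derive1 (fun x => - w x) (local_abscissa D E X) =
   - derive1 w (local_abscissa D E X).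
  by rewrite !derive1E deriveN.
by rewrite sqrrN scaleNr -opprD scalerN.
Qed.

Lemma dotNr (X Y : R * R) : dot X (- Y) = - dot X Y.
Proof. by rewrite /dot /= !mulrN opprD. Qed.

Lemma dotC (X Y : R * R) : dot X Y = dot Y X.
Proof. by rewrite /dot !(mulrC X.1) !(mulrC X.2). Qed.

Lemma dotDr (X Y Z : R * R) : dot X (Y + Z) = dot X Y + dot X Z.
Proof. by rewrite /dot /=; ring. Qed.

Lemma dotZr (a : R) (X Y : R * R) : dot X (a *: Y) = a * dot X Y.
Proof. by rewrite /dot /= /GRing.scale /=; ring. Qed.

(** A node strictly on the wrong side of the chord would be adherent to a subelement that
    [node_above] excludes. The second sign is the first one with the normal and the graph reversed
    and the two sides exchanged. *)
Lemma node_signs (k : fe_kind) (Omega G : set (R * R)) (Os : side -> set (R * R)) (h : R)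
    (Th : seq (elt R k)) (T : elt R k) (P : R * R) (sw sx sy : bool) (D E n : R * R)
    (w : R -> R) (sd : R * R -> side) :
  0 < h -> (forall i, T i = P + axis_isometry sw sx sy (ref_vertex h i)) ->
  separates G Omega Os -> cartesian_mesh Omega h Th -> interface_elt G Th T ->
  local_interface G Os T D E n w -> side_rule T Os sd ->
  forall j, (sd (node T j) = Minus -> dot (node T j - D) n <= 0) /\
            (sd (node T j) = Plus -> 0 <= dot (node T j - D) n).
Proof.
move=> h0 TE [_ dOs OMP OG] [_ mesh _ _] [TTh Tint] [[DE GB] [nn nt] cw GT nrm] hsd j.
have oO s : open (Os s) by have [] := dOs s.
have off X : (carrier T)° X -> ~ G X -> Os Minus X \/ Os Plus X.
  move=> TX GX; have : (Omega `\` G) X by split => //; exact: (mesh _ TTh).2.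
  by rewrite OG.
have dw x : derivable w x 1 by exact: C2_derivable.
have [i cM _] := node_boundary h0 TE j.
have clM := hsd _ cM.
split=> sdj; rewrite sdj in clM; rewrite leNgt; apply/negP => hj.
- apply: (@node_above k G h T P sw sx sy D E n w (Os Plus) (Os Minus)
    _ _ _ _ _ _ _ _ _ _ _ _ _ _ j) clM => //.
  + by rewrite setIC.
  + by move=> X TX GX; case: (off X TX GX); [right|left].
  + move=> X GX TX; have := nrm X GX TX.
    by apply: filterS => d [[]].
- apply: (@node_above k G h T P sw sx sy D E (- n) (fun x => - w x) (Os Minus) (Os Plus)
    _ _ _ _ _ _ _ _ _ _ _ _ _ _ j) clM => //.
  + by rewrite dotNr dotC dotNr opprK.
  + by rewrite dotC dotNr dotC nt oppr0.
  + by move=> x; apply: derivableN.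
  + rewrite GT; apply/seteqP; split => X [xi hxi <-]; exists xi => //;
      by rewrite local_pt_opp.
  + move=> X GX TX; have := nrm X GX TX.
    apply: filterS => d [_ []] _; rewrite interface_normal_opp//.
    by rewrite scalerN.
  + by rewrite dotNr oppr_gt0.
Qed.
End Nodes.

(** * The sum of the shape functions *)

Section Sums.
Variable R : realType.

Definition psum (I : finType) (p : I -> poly2 R) : poly2 R :=
  Poly2 (\sum_i c0 (p i)) (\sum_i cx (p i)) (\sum_i cy (p i)) (\sum_i deg2 (p i)).

Definition pshift (p : poly2 R) (a : R) : poly2 R := Poly2 (c0 p + a) (cx p) (cy p) (deg2 p).

Lemma peval_shift k p a X : peval k (pshift p a) X = peval k p X + a.
Proof. by rewrite /peval /=; case: k; ring. Qed.

Lemma pgrad_shift k p a X : pgrad k (pshift p a) X = pgrad k p X.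
Proof. by case: k. Qed.

Lemma peval_sum k (I : finType) (p : I -> poly2 R) X :
  peval k (psum p) X = \sum_i peval k (p i) X.
Proof.
case: k; rewrite /peval /= !big_split /= -?mulr_suml ?mulr_suml ?big1_eq //.
all: by rewrite !mulr_suml.
Qed.

Lemma dot_pgrad_sum k (I : finType) (p : I -> poly2 R) X m :
  dot (pgrad k (psum p) X) m = \sum_i dot (pgrad k (p i) X) m.
Proof.
by case: k; rewrite /dot /pgrad /= big_split /= -!mulr_suml ?sumrB ?big_split /=
  -?mulr_suml -?mulr_sumr.
Qed.

Lemma pgrad_const (k : fe_kind) (p : poly2 R) : (forall X, peval k p X = 0) ->
  forall X, pgrad k p X = 0.
Proof.
move=> p0 X; rewrite -grad_peval.
have -> : peval k p = cst 0 by apply/funext => Y; rewrite p0.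
by rewrite /grad !derive_cst.
Qed.

Lemma sum_grad k (I : finType) (p : I -> poly2 R) X :
  \sum_i grad (peval k (p i)) X = grad (peval k (psum p)) X.
Proof.
have dE (Y : R * R) : Y = (dot Y (1, 0), dot Y (0, 1)).
  by case: Y => y1 y2; rewrite /dot /= !mulr1 !mulr0 addr0 add0r.
have dS m : dot (\sum_i grad (peval k (p i)) X) m = \sum_i dot (grad (peval k (p i)) X) m.
  apply: (big_morph (fun Y => dot Y m)) => [Y Z|]; last by rewrite /dot /= !mul0r addr0.
  by rewrite /dot /=; ring.
rewrite [LHS]dE [RHS]dE !dS grad_peval !dot_pgrad_sum.
by congr pair; apply: eq_bigr => i _; rewrite grad_peval.
Qed.

Lemma in_square_ref_coord k h (T : elt R k) (P : R * R) sw sx sy X : 0 < h ->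
  (forall i, T i = P + axis_isometry sw sx sy (ref_vertex h i)) ->
  carrier T X -> in_square h (ref_coord P sw sx sy X).
Proof.
move=> h0 TE; rewrite (carrierE h0 TE) => hX.
have S (j : nat) (jk : (j < nI k)%N) : 0 <= elt_side k h P sw sx sy j X by exact: (hX (Ordinal jk)).
have := S 0%N; have := S 1%N; have := S 2%N; have := S 3%N.
rewrite /elt_side /ref_side /in_square; move: (ref_coord _ _ _ _ _) => Y.
clear; case: k => /= s3 s2 s1 s0; have := s0 isT; have := s1 isT; have := s2 isT;
  try (have := s3 isT); move=> *; split; lra.
Qed.

Definition edge_code (i : nat) : bool * bool :=
  match i with 0 => (true, false) | 1 => (false, true) | 2 => (true, true) | _ => (false, false) end.

Lemma on_edge_ref_coord k h (T : elt R k) (P : R * R) sw sx sy X (i : 'I_(nI k)) :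
  rectangular k -> 0 < h ->
  (forall i, T i = P + axis_isometry sw sx sy (ref_vertex h i)) -> edge T i X ->
  on_edge (edge_code i) ((ref_coord P sw sx sy X).1 / h) ((ref_coord P sw sx sy X).2 / h).
Proof.
move=> rk h0 TE /(edgeE h0 TE)[_]; rewrite /elt_side; move: (ref_coord _ _ _ _ _) => Y.
have h_neq0 : h != 0 by rewrite gt_eqF.
rewrite /on_edge /ref_side rk; case: (nat_of_ord i) => [|[|[|j]]] /=.
- by move=> ->; rewrite mul0r.
- by move/subr0_eq => <-; rewrite divff.
- by move/subr0_eq => <-; rewrite divff.
- by move=> ->; rewrite mul0r.
Qed.

Lemma edge_code_inj k (i j : 'I_(nI k)) : i != j -> edge_code i != edge_code j.
Proof. by case: k i j => -[[|[|[|[|i]]]] //= ?] [[|[|[|[|j]]]] //= ?]. Qed.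

Lemma ref_coordB (P : R * R) sw sx sy (X D : R * R) :
  ref_coord P sw sx sy X - ref_coord P sw sx sy D = iso_inv sw sx sy (X - D).
Proof.
have -> : X - D = (-1) *: (D - P) + (X - P) by rewrite scaleN1r opprB addrAC addrCA subrr addr0 addrC.
by rewrite iso_inv_lin scaleN1r addrC.
Qed.

Lemma dot_ref_coord (P : R * R) sw sx sy (X D n : R * R) :
  dot (ref_coord P sw sx sy X - ref_coord P sw sx sy D) (iso_inv sw sx sy n) = dot (X - D) n.
Proof. by rewrite ref_coordB dot_iso_inv. Qed.

Lemma ref_coord_midpoint (P : R * R) sw sx sy (D E n : R * R) (a : R) :
  ref_coord P sw sx sy (2^-1 *: (D + E) + a *: n) =
  2^-1 *: (ref_coord P sw sx sy D + ref_coord P sw sx sy E) + a *: iso_inv sw sx sy n.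
Proof.
case: P D E n => ? ? [? ?] [? ?] [? ?]; rewrite /ref_coord /iso_inv /axis_isometry.
by case: sw sx sy => -[] []; congr pair; rewrite /= /GRing.scale /= /GRing.scale /=; field.
Qed.
End Sums.

(** * The flux point in reference coordinates *)

Section FluxPoint.
Variable R : realType.

Lemma aff_dot (n D Y : R * R) : aff (- dot D n) n.1 n.2 Y = dot (Y - D) n.
Proof. by rewrite /aff /dot /=; ring. Qed.

Lemma max_curvature_ge0 (G : set (R * R)) kappa : is_max_curvature G kappa -> 0 <= kappa.
Proof.
move=> [[c [a [b [t [_ _ _ ->]]]]] _].
by rewrite /curvature divr_ge0// exprn_ge0// sqrtr_ge0.
Qed.

Lemma in_square_enorm h (X Y : R * R) : in_square h X -> in_square h Y ->
  dot (Y - X) (Y - X) <= 2 * h ^+ 2.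
Proof. by case: X Y => [x1 x2] [y1 y2]; rewrite /in_square /dot /= => -[? ?] [? ?]; nra. Qed.

Section Flux.
Variables (k : fe_kind) (G : set (R * R)) (h kappa eps kbar bm bp : R) (T : elt R k).
Variables (P : R * R) (sw sx sy : bool) (D E n : R * R) (w : R -> R) (F : R * R).
Hypotheses (h0 : 0 < h) (TE : forall i, T i = P + axis_isometry sw sx sy (ref_vertex h i)).
Hypotheses (huni : unisolvence_conditions k h kappa eps kbar (bm / bp)) (hb : 0 < bm <= bp).
Hypotheses (hk : is_max_curvature G kappa) (DE : D <> E).
Hypotheses (GD : (G `&` carrier T) D) (GE : (G `&` carrier T) E).
Hypotheses (nn : dot n n = 1) (nt : dot n (E - D) = 0) (cw : C2 w).
Hypothesis GT : G `&` carrier T = [set local_pt D E n xi (w xi) | xi in `[0, enorm (E - D)]].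
Hypothesis diff_edges : exists i j, [/\ i != j, edge T i D & edge T j E].
Hypothesis hF : flux_point G T D E n w F.
Local Notation L := (enorm (E - D)).
Local Notation rc := (ref_coord P sw sx sy).

Lemma GT_param X : (G `&` carrier T) X ->
  exists xi, [/\ 0 <= xi <= L, X = local_pt D E n xi (w xi) & frame_coord D E n X = (xi, w xi)].
Proof.
rewrite GT => -[xi /=]; rewrite in_itv /= => hxi <-; exists xi; split => //.
exact: local_ptK.
Qed.

Lemma graph_start : w 0 = 0.
Proof.
have [xi [_ _]] := GT_param GD.
by rewrite /frame_coord subrr /dot /= !mul0r addr0 => -[<-].
Qed.

Lemma graph_end : w L = 0.
Proof.
have L0 : L != 0.
  by rewrite gt_eqF// enorm_gt0// => /eqP; rewrite subr_eq0 => /eqP ED; exact: DE.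
have [xi [_ _]] := GT_param GE; rewrite /frame_coord (dotC _ n) nt => -[hx hw].
suff -> : L = xi by [].
by rewrite -hx /tangent dotZr -sqr_enorm expr2 mulKf.
Qed.

Lemma chord_gt0 : 0 < L.
Proof. by rewrite enorm_gt0// => /eqP; rewrite subr_eq0 => /eqP ED; exact: DE. Qed.

Lemma chord_le : L ^+ 2 <= 2 * h ^+ 2.
Proof.
rewrite sqr_enorm -(dot_iso_inv sw sx sy) -!(ref_coordB P).
exact: in_square_enorm (in_square_ref_coord h0 TE GD.2) (in_square_ref_coord h0 TE GE.2).
Qed.

Lemma slope_bound t : 0 <= t <= L -> (4 - kbar) * derive1 w t ^+ 2 <= kbar.
Proof.
move=> ht; have k0 := max_curvature_ge0 hk.
have GTG : [set local_pt D E n xi (w xi) | xi in `[0, L]] `<=` G by rewrite -GT => X [].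
have H := graph_curvature DE nn nt cw GTG hk.
have w0L : w 0 = w L by rewrite graph_start graph_end.
have := slope_le chord_gt0 cw w0L H ht.
apply: slope_of_sine_le; first by rewrite mulr_ge0// ltW// chord_gt0.
exact: curvature_chord huni h0 k0 chord_le.
Qed.

(** s is the sign by which the tangent, read in reference coordinates, differs from (n'.2, - n'.1);
    it moves into the slope, so that n - p t becomes (n1 - p n2, n2 + p n1) with p replaced by p
    s. *)
Lemma flux_condition (s : R) : s ^+ 2 = 1 ->
  let n' := iso_inv sw sx sy n in
  ref_condition k h (- dot (rc D) n') n'.1 n'.2 bm bp
    (derive1 w (local_abscissa D E F) * s) (rc D) (rc E) (rc F).
Proof.
move=> s2 n'; have [FT Fk] := hF.
have [xi [hxi FE Fc]] := GT_param FT.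
have absF : local_abscissa D E F = xi by rewrite -[xi]/((xi, w xi).1) -Fc.
have s1 : `|s| = 1.
  by apply/eqP; rewrite -(@eqrXn2 _ 2)// real_normK ?num_real// s2 expr1n.
have hp := slope_bound hxi.
have [_ hkb _ huk] := huni.
have tt := dot_tangent DE; have ntT := dot_normal_tangent nt.
(* The tangential component of the unit normal is proportional to the slope. *)
have tri : interface_normal D E n w F = n -> derive1 w (local_abscissa D E F) * s = 0.
  rewrite absF /interface_normal absF => /(congr1 (fun X => dot (tangent D E) X)).
  rewrite -/(tangent D E) dotZr dotDr dotNr dotZr tt dotC ntT mulr1 sub0r => /eqP.
  rewrite mulf_eq0 invr_eq0 sqrtr_eq0 leNgt ltr_wpDr ?sqr_ge0//= oppr_eq0 => /eqP->.
  by rewrite mul0r.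
rewrite absF in tri *.
have onE : rectangular k -> exists e e', [/\ e != e', on_edge e ((rc D).1 / h) ((rc D).2 / h)
    & on_edge e' ((rc E).1 / h) ((rc E).2 / h)].
  move=> rk; have [i [j [ij Di Ej]]] := diff_edges.
  exists (edge_code i), (edge_code j).
  by split; [exact: edge_code_inj|exact: on_edge_ref_coord TE _|exact: on_edge_ref_coord TE _].
have F2 : aff (- dot (rc D) n') n'.1 n'.2 (rc F) = w xi.
  by rewrite aff_dot dot_ref_coord -[w xi]/((xi, w xi).2) -Fc.
have rcF : proj_line D E F = 2^-1 *: (D + E) -> rc F = 2^-1 *: (rc D + rc E) + w xi *: (n'.1, n'.2).
  rewrite /proj_line absF -/(tangent D E) => Fm.
  have -> : F = 2^-1 *: (D + E) + w xi *: n by rewrite -Fm {1}FE.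
  by rewrite ref_coord_midpoint -surjective_pairing.
rewrite /ref_condition normrM s1 mulr1; move: huk Fk onE; case: (k) => huk Fk onE.
- exact: tri.
- split; first by apply: slope_bilinear huk hp; case/andP: hkb.
  have [e [e' [ee De Ee]]] := onE isT; exists e, e', (w xi); split => //.
  exact: rcF.
- exact: tri.
- have [Q1 Q2] := slope_rotated hb hkb huk.
  exists (3 / 5 * Num.sqrt kbar); split => //; first exact: Q1.
  have [/andP[x0 xL] q0] : 0 <= xi <= L /\ 0 <= 3 / 5 * Num.sqrt kbar.
    by split => //; rewrite mulr_ge0 ?sqrtr_ge0 ?divr_ge0.
  have dw (t : R) : is_derive t 1 w (derive1 w t) by exact/is_derive_derive1/C2_derivable.
  have [c] := @MVT_segment R w (derive1 w) 0 xi x0 (fun t _ => dw t)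
    (continuous_subspaceT (C2_continuous cw)).
  rewrite in_itv /= graph_start !subr0 => /andP[c0 cxi] wE; rewrite F2 wE normrM (ger0_norm x0).
  (* F is at height at most q xi <= q L over the chord, and sqrt 2 <= 3/2: this is the factor 3/2 of
     [ref_condition]. *)
  have Lh : L <= 3 / 2 * h by have := chord_le; have := chord_gt0; have := h0; nra.
  rewrite mulrAC [leRHS]mulrC; apply: ler_pM => //.
    by apply: Q1; apply: slope_bound; lra.
  lra.
Qed.
End Flux.
End FluxPoint.

Theorem lemma5p3 (R : realType) (k : fe_kind)
  (Omega Gamma : set (R * R)) (Omegas : side -> set (R * R))
  (h kappa eps kbar : R) (beta : side -> R) (Th : seq (elt R k))
  (hOmega : rect_domain Omega)
  (hsep : separates Gamma Omega Omegas)
  (hmesh : cartesian_mesh Omega h Th)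
  (hstd : standing_hypotheses Gamma Th)
  (hkappa : is_max_curvature Gamma kappa)
  (hbeta : 0 < beta Minus <= beta Plus)
  (huni : unisolvence_conditions k h kappa eps kbar (beta Minus / beta Plus))
  (T : elt R k) (hT : interface_elt Gamma Th T)
  (D E nbar : R * R) (omega : R -> R)
  (hloc : local_interface Gamma Omegas T D E nbar omega)
  (F : R * R) (hF : flux_point Gamma T D E nbar omega F)
  (sd : R * R -> side) (hsd : side_rule T Omegas sd)
  (phi : 'I_(nI k) -> side -> poly2 R)
  (hphi : forall i, ife_shape T D E nbar omega beta F sd i (phi i)) :
  (forall X, carrier T X -> \sum_i pw_eval sd (ife k (phi i)) X = 1) /\
  (forall X, carrier T X ->
     pw_grad sd (fun s Y => \sum_i ife k (phi i) s Y) X =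
       \sum_i pw_grad sd (ife k (phi i)) X /\
     \sum_i pw_grad sd (ife k (phi i)) X = 0).
Proof.
have hl := hloc; case: (hl) => -[DE GB] [nn nt] cw GT _.
have hm := hmesh; case: (hm) => h0 mesh _ _.
have [TTh Tint] := hT.
have [[P [sw [sx [sy TE]]]] _] := mesh T TTh.
have signs := node_signs h0 TE hsep hmesh hT hl hsd.
have bd X : (Gamma `&` boundary T) X -> (Gamma `&` carrier T) X.
  by move=> [GX [i _ /(edgeE h0 TE)[cX _]]].
have GD : (Gamma `&` carrier T) D by apply: bd; rewrite GB; left.
have GE : (Gamma `&` carrier T) E by apply: bd; rewrite GB; right.
have diff_edges : exists i j, [/\ i != j, edge T i D & edge T j E].
  by case: hstd => _ + _ _; apply.
pose v s := pshift (psum (fun i => phi i s)) (-1).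
have vE s X : peval k (v s) X = \sum_i peval k (phi i s) X - 1.
  by rewrite peval_shift peval_sum.
(* Both pieces vanish on the whole plane, so their gradients vanish too, whichever piece is counted
   at X. *)
suff v0 s X : peval k (v s) X = 0.
  have v1 s X : \sum_i peval k (phi i s) X = 1.
    by apply/eqP; rewrite -subr_eq0 -vE v0.
  have g0 s X : grad (peval k (psum (fun i => phi i s))) X = 0.
    by rewrite grad_peval -(pgrad_shift k _ (-1)); apply: pgrad_const; exact: v0.
  split=> [X _|X _]; first exact: v1.
  rewrite /pw_grad /ife sum_grad g0; split => //.
  have -> : (fun Y => \sum_i peval k (phi i (sd X)) Y) = peval k (psum (fun i => phi i (sd X))).
    by apply/funext => Y; rewrite peval_sum.
  exact: g0.
pose rc := ref_coord P sw sx sy.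
(* The sign combines the orientation of the frame with a possible reflection in the mesh
   isometry. *)
have [sg sg2 tE] : exists2 sg : R, sg ^+ 2 = 1 & iso_inv sw sx sy (tangent D E) =
    sg *: ((iso_inv sw sx sy nbar).2, - (iso_inv sw sx sy nbar).1).
  apply: frame_det; rewrite dot_iso_inv //; first exact: dot_tangent.
  exact: dot_normal_tangent.
have cond := flux_condition h0 TE huni hbeta hkappa DE GD GE nn nt cw GT diff_edges hF sg2.
pose n' := iso_inv sw sx sy nbar.
pose u s := pull k P sw sx sy (v s).
suff u0 : forall s Y, peval k (u s) Y = 0.
  by rewrite -(ref_coordK P sw sx sy X) -peval_pull; exact: u0.
have [GF _] := hF.
have nE : n'.1 ^+ 2 + n'.2 ^+ 2 = 1 by rewrite -nn -(dot_iso_inv sw sx sy) /dot !expr2.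
have lineE Y : aff (- dot (rc D) n') n'.1 n'.2 Y = dot (P + axis_isometry sw sx sy Y - D) nbar.
  by rewrite aff_dot -{1}(ref_coord_iso P sw sx sy Y) dot_ref_coord.
apply: (ref_unisolvent (sd := fun j => sd (node T j)) h0 nE hbeta
  (in_square_ref_coord h0 TE GD.2) (in_square_ref_coord h0 TE GE.2)
  (in_square_ref_coord h0 TE GF.2) _ _ _ cond).
- by move=> /(congr1 (fun Y => P + axis_isometry sw sx sy Y)); rewrite !ref_coordK.
- by rewrite lineE ref_coordK subrr /dot /= !mul0r addr0.
- by rewrite lineE ref_coordK dotC.
- move=> Y; rewrite lineE !peval_pull !vE => hY; congr (_ - _).
  have lY : line D E (P + axis_isometry sw sx sy Y).
    exists (local_abscissa D E (P + axis_isometry sw sx sy Y) / enorm (E - D)).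
    rewrite -{1}(frame_coordK DE nn nt (P + _)) /frame_coord hY /local_pt scale0r addr0.
    by rewrite scalerA.
  by apply: eq_bigr => i _; case: (hphi i) => /(_ _ lY).
- move=> rk; rewrite /u /pull /=; congr (_ * _).
  by apply: eq_bigr => i _; case: (hphi i) => _ /(_ rk).
- set p := derive1 omega _ * sg.
  have mE : (n'.1 - p * n'.2, n'.2 + p * n'.1) =
      iso_inv sw sx sy (nbar - derive1 omega (local_abscissa D E F) *: tangent D E).
    rewrite [nbar - _]addrC -(scaleNr _ (tangent D E)) iso_inv_lin tE scalerA /p -/n'.
    by congr pair; rewrite /= /GRing.scale /=; ring.
  have dE s1 : dot (pgrad k (u s1) (rc F)) (n'.1 - p * n'.2, n'.2 + p * n'.1) =
      \sum_i dot (grad (peval k (phi i s1)) F)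
        (nbar - derive1 omega (local_abscissa D E F) *: tangent D E).
    rewrite mE pgrad_pull iso_invK ref_coordK pgrad_shift dot_pgrad_sum.
    by apply: eq_bigr => i _; rewrite grad_peval.
  apply: etrans (congr1 _ (dE Minus)) (etrans _ (esym (congr1 _ (dE Plus)))).
  rewrite !mulr_sumr.
  apply: eq_bigr => i _; case: (hphi i) => _ _ + _.
  rewrite /interface_normal -/(tangent D E) !dotZr.
  (* The flux condition is homogeneous in the normal, so the normalizing factor of the unit normal
     cancels. *)
  set c := (Num.sqrt _)^-1 => flux; have c_neq0 : c != 0.
    by rewrite gt_eqF// invr_gt0 sqrtr_gt0 ltr_wpDr ?sqr_ge0.
  by apply: (mulfI c_neq0); rewrite !(mulrCA c).
- move=> j; rewrite peval_pull -(nodeE TE) vE.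
  rewrite (eq_bigr (fun i => (i == j)%:R)); last first.
    by move=> i _; case: (hphi i) => _ _ _ /(_ j).
  by rewrite (bigD1 j)//= eqxx big1 ?addr0 ?subrr// => i /negPf->.
- by move=> j sdj; rewrite lineE -(nodeE TE); exact: (signs j).1.
- by move=> j sdj; rewrite lineE -(nodeE TE); exact: (signs j).2.
Qed.
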